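(* For each $n\ge1$ let $\mathcal{C}_2(\mathbb{T}^n)$ be the collection of (almost everywhere defined) functions on $\mathbb{T}^n$ of the form $(z_1,\dots,z_n)\mapsto\log|P(z_1,\dots,z_n)|$, where $P\in\mathbb{C}[Z_1^{\pm1},\dots,Z_n^{\pm1}]$ is a nonzero Laurent polynomial. Then $\mathcal{C}_2=\bigcup_{n\ge1}\mathcal{C}_2(\mathbb{T}^n)$ is a Boyd--Lawton collection.
   Context: $\mathbb{T}$ is the unit circle in $\mathbb{C}$; $\mathbb{T}^n=\{(z_1,\dots,z_n)\in\mathbb{C}^n: |z_1|=\dots=|z_n|=1\}$ is a compact group under coordinatewise multiplication, with normalized Haar measure $\tau_n$ (total mass 1); $\tau=\tau_1$. For an $n\times m$ integer matrix $A=(a_{ij})$, $q_A\colon\mathbb{T}^m\to\mathbb{T}^n$ is the continuous homomorphism $q_A(z_1,\dots,z_m)=(z_1^{a_{11}}z_2^{a_{12}}\cdots z_m^{a_{1m}},\dots,z_1^{a_{n1}}z_2^{a_{n2}}\cdots z_m^{a_{nm}})$. A vector $\mathbf{r}\in\mathbb{Z}^n$ is viewed as an $n\times1$ matrix, so $q_{\mathbf{r}}\colon\mathbb{T}\to\mathbb{T}^n$, $q_{\mathbf r}(z)=(z^{r_1},\dots,z^{r_n})$. The Boyd height is $\mu(q_A)=\mu(A)=\min\{\|\mathbf{v}\|_\infty:\mathbf{v}\in\mathbb{Z}^n,\ \mathbf{v}\ne\mathbf{0},\ \mathbf{v}\cdot A=\mathbf{0}\}$ ($\mathbf v$ a row vector),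 and $\mu(q_A)=\infty$ if no such $\mathbf{v}$ exists. A Boyd--Lawton collection $\mathcal{C}=\bigcup_{n\ge1}\mathcal{C}(\mathbb{T}^n)$ is a collection of functions such that: (1) If $g\in\mathcal{C}(\mathbb{T}^n)$ then $g$ is defined and complex-valued almost everywhere on $\mathbb{T}^n$ and is integrable (it gives an element of $L^1(\mathbb{T}^n)$). (2) For each $g\in\mathcal{C}(\mathbb{T}^n)$ with $n\ge2$, $\int_{\mathbb{T}^n}g\,d\tau_n=\lim_{\mu(q_{\mathbf r})\to\infty}\int_{\mathbb{T}}g\circ q_{\mathbf r}\,d\tau$, where $q_{\mathbf r}\colon\mathbb{T}\to\mathbb{T}^n$ varies over the homomorphisms given by $\mathbf r\in\mathbb{Z}^n$ (implicit: for all large enough $\mu(q_{\mathbf r})$ the function $g\circ q_{\mathbf r}$ is integrable). The limit means: for every $\varepsilon>0$ there is $M$ such that the two integrals differ by less than $\varepsilon$ whenever $\mu(q_{\mathbf r})\ge M$. (3) If $g\in\mathcal{C}(\mathbb{T}^n)$, there is a bound $B$ such that for every $m\ge1$ and every $q_A\colon\mathbb{T}^m\to\mathbb{T}^n$ with $\mu(q_A)\ge B$, the composition $g\circ q_A$ is in $\mathcal{C}(\mathbb{T}^m)$. Functions are actual (partially defined) functions; $\log|P|$ is defined at the points where $P\neq0$, and $g\circ q_A$ is defined at the points that $q_A$ maps into the domain of $g$. *)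

(* Defs.v *)
From HB Require Import structures.
From mathcomp Require Import all_boot all_order all_algebra finmap.
From mathcomp Require Import all_classical all_reals all_analysis.
From mathcomp Require Import measurable_realfun complex.

Set Implicit Arguments.
Unset Strict Implicit.
Unset Printing Implicit Defensive.

Import Order.TTheory GRing.Theory Num.Theory.
Import numFieldNormedType.Exports.

Local Open Scope classical_set_scope.
Local Open Scope ring_scope.

Section Circle.
Variable R : realType.

Record circle := Circle { circle_val :> R[i]; _ : `|circle_val| == 1 }.

HB.instance Definition _ := [isSub for circle_val].
HB.instance Definition _ := [Choice of circle by <:].

Lemma circle_point_subproof : `|1 : R[i]| == 1.
Proof. by rewrite normr1. Qed.

HB.instance Definition _ :=
  isPointed.Build circle (Circle circle_point_subproof).

Lemma circle_norm (z : circle) : `|z : R[i]| = 1.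
Proof. by apply/eqP; exact: (valP z). Qed.

Lemma circle_mul_subproof (x y : circle) : `|(x : R[i]) * y| == 1.
Proof. by rewrite normrM !circle_norm mulr1. Qed.

Definition circle_mul (x y : circle) : circle := Circle (circle_mul_subproof x y).

Definition circle_coords (z : circle) : R * R := (complex.Re z, complex.Im z).

(* The sigma-algebra induced by the inclusion in R^2, that is, the Borel
   sigma-algebra of the unit circle. *)
Definition circle_measurable : set (set circle) :=
  preimage_set_system setT circle_coords measurable.

Lemma circle_sigma_algebra : sigma_algebra setT circle_measurable.
Proof. by apply: sigma_algebra_preimage; exact: sigma_algebra_measurable. Qed.

Lemma circle_measurable0 : circle_measurable set0.
Proof. by case: circle_sigma_algebra. Qed.

Lemma circle_measurableC A : circle_measurable A -> circle_measurable (~` A).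
Proof. by case: circle_sigma_algebra => _ + _ mA => /(_ _ mA); rewrite setTD. Qed.

Lemma circle_measurable_bigcup (F : (set circle)^nat) :
  (forall i, circle_measurable (F i)) -> circle_measurable (\bigcup_i F i).
Proof. by case: circle_sigma_algebra => _ _; exact. Qed.

End Circle.

Definition circle_display : measure_display. Proof. exact: default_measure_display. Qed.

HB.instance Definition _ (R : realType) :=
  @isMeasurable.Build circle_display (circle R) (@circle_measurable R)
    (@circle_measurable0 R) (@circle_measurableC R)
    (@circle_measurable_bigcup R).

Section CircleMeasure.
Variable R : realType.

Lemma measurable_circle_coords : measurable_fun setT (@circle_coords R).
Proof. by move=> _ Y mY; exists Y. Qed.

Lemma measurable_circleP d (T : measurableType d) (f : T -> circle R) :
  measurable_fun setT (@circle_coords R \o f) -> measurable_fun setT f.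
Proof.
move=> mf _ _ [Y mY <-]; rewrite !setTI -comp_preimage -[X in measurable X]setTI.
exact: mf.
Qed.

Lemma expi_subproof (t : R) : `|Complex (cos t) (sin t)| == 1.
Proof. by rewrite normc_def /= cos2Dsin2 sqrtr1. Qed.

Definition expi (t : measurableTypeR R) : circle R := Circle (expi_subproof t).

Lemma measurable_expi : measurable_fun [set: measurableTypeR R] expi.
Proof.
apply: measurable_circleP; apply/measurable_fun_pairP; split.
  by apply: continuous_measurable_fun; exact: continuous_cos.
by apply: continuous_measurable_fun; exact: continuous_sin.
Qed.

HB.instance Definition _ := 
  isMeasurableFun.Build _ _ _ _ expi measurable_expi.

Lemma two_pi_gt0 : 0 < pi *+ 2 :> R.
Proof. by rewrite mulrn_wgt0// pi_gt0. Qed.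

(* The law of exp(i t) for t uniform on [0, 2 pi]; haarM below shows that it and
   its powers are translation invariant. *)
Definition circle_haar : probability (circle R) R :=
  distribution (uniform_prob two_pi_gt0) expi.

Definition torus_cons n (p : circle R * n.-tuple (circle R)) :
  n.+1.-tuple (circle R) := [the n.+1.-tuple (circle R) of p.1 :: p.2].

Lemma measurable_torus_cons n : measurable_fun setT (@torus_cons n).
Proof. by apply: measurable_cons => //; exact: measurable_snd. Qed.

HB.instance Definition _ n :=
  isMeasurableFun.Build _ _ _ _ (@torus_cons n) (@measurable_torus_cons n).

Fixpoint haar n : probability (n.-tuple (circle R)) R :=
  if n is k.+1 then
    distribution [the probability _ _ of (circle_haar \x haar k)%E] (@torus_cons k)
  else [the probability _ _ of \d_ [tuple]].

Definition torus_mul n (x y : n.-tuple (circle R)) : n.-tuple (circle R) :=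
  [tuple circle_mul (tnth x i) (tnth y i) | i < n].

End CircleMeasure.

Section HaarInvariance.
Variable R : realType.

Lemma circle_inj (x y : circle R) : (x : R[i]) = y -> x = y.
Proof. exact: val_inj. Qed.

Lemma expiD (s t : R) : expi (s + t) = circle_mul (expi s) (expi t).
Proof.
apply: circle_inj; rewrite /=; apply/eqP; rewrite eq_complex /= cosD sinD.
by rewrite eqxx /= addrC.
Qed.

Lemma expi2pi : expi (pi *+ 2 : R) = expi (0 : R).
Proof. by apply: circle_inj; rewrite /= cos2pi sin2pi cos0 sin0. Qed.

Lemma expi_surj (a : circle R) : exists2 t : R, 0 <= t <= pi *+ 2 & a = expi t.
Proof.
case: a => -[x y] a1; have xy1 : x ^+ 2 + y ^+ 2 = 1.
  move: (a1); rewrite normc_def /= => /eqP/(congr1 (@complex.Re R))/= h.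
  by rewrite -[LHS]sqr_sqrtr ?addr_ge0 ?sqr_ge0// h expr1n.
have x1 : -1 <= x <= 1.
  rewrite -ler_norml -(@ler_pXn2r _ 2)// ?nnegrE// expr1n real_normK ?num_real//.
  by rewrite -xy1 lerDl sqr_ge0.
have /andP[t0 tpi] : 0 <= acos x <= pi by rewrite acos_ge0//= acos_lepi.
have y2 : 1 - x ^+ 2 = y ^+ 2 by rewrite -xy1 addrC addKr.
have [y0|y0] := leP 0 y.
- exists (acos x).
    by rewrite t0 (le_trans tpi)// mulr2n lerDl pi_ge0.
  apply: circle_inj; rewrite /= acosK; last by rewrite in_itv.
  by rewrite sin_acos// y2 sqrtr_sqr ger0_norm.
- exists (pi *+ 2 - acos x).
    rewrite subr_ge0 (le_trans tpi) ?mulr2n ?lerDl ?pi_ge0//=.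
    by rewrite gerBl.
  apply: circle_inj; rewrite /= [pi *+ 2 - _]addrC cosD2pi sinD2pi cosN sinN.
  rewrite acosK; last by rewrite in_itv.
  by rewrite sin_acos// y2 sqrtr_sqr ltr0_norm// opprK.
Qed.

Lemma lebesgue_measureDr (a : R) (A : set R) : measurable A ->
  lebesgue_measure ((fun x => x + a) @^-1` A) = lebesgue_measure A.
Proof.
move=> mA; have mf : measurable_fun [set: measurableTypeR R]
    (fun x : measurableTypeR R => (x + a : measurableTypeR R)).
  exact: measurable_funD.
pose f : measurableTypeR R -> measurableTypeR R := fun x => x + a.
have -> : lebesgue_measure ((fun x => x + a) @^-1` A) =
    pushforward lebesgue_measure f A by [].
apply/esym/lebesgue_measure_unique => //= _ [[b c]] _ <-.
rewrite /pushforward.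
have -> : f @^-1` [set` `]b, c]] = [set` `]b - a, c - a]].
  by apply/seteqP; split=> x /=; rewrite !in_itv /= ltrBlDr lerBrDr.
rewrite !lebesgue_measure_itv /= !lte_fin ltrD2r.
by case: ifP => // _; rewrite -!EFinD opprB addrA subrK.
Qed.

Lemma uniform_probE (A : set R) : measurable A ->
  uniform_prob (two_pi_gt0 R) A =
  (((pi *+ 2 : R)^-1)%:E * lebesgue_measure (A `&` `[0%R, (pi *+ 2)%R[))%E.
Proof.
move=> mA; rewrite /uniform_prob integral_uniform_pdf.
rewrite (eq_integral (cst ((pi *+ 2 : R)^-1)%:E)); last first.
  by move=> x; rewrite inE/= in_itv/= /uniform_pdf subr0 => -[_ ->].
rewrite integral_cst/=; last exact: measurableI.
rewrite -(@setUitv1 _ _ _ _ true)/=; last by rewrite bnd_simp ltW// two_pi_gt0.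
rewrite setIUr measureU0//.
- exact: measurableI.
- exact: measurableI.
- apply/eqP; rewrite -measure_le0 -(lebesgue_measure_set1 (pi *+ 2 : R)).
  by apply: le_measure; rewrite ?inE//; exact: measurableI.
Qed.

Lemma circle_haarM (a : circle R) (A : set (circle R)) : measurable A ->
  circle_haar R (circle_mul a @^-1` A) = circle_haar R A.
Proof.
move=> mA; have [t /andP[t0 t2pi] ->] := expi_surj a.
pose B : set R := @expi R @^-1` A.
have mB : measurable B.
  by rewrite -[B]setTI; exact: measurable_expi.
have BE : @expi R @^-1` (circle_mul (expi t) @^-1` A) = (fun x => x + t) @^-1` B.
  by apply/seteqP; split=> x; rewrite /B /= addrC expiD.
have Bper : (fun x => x + pi *+ 2) @^-1` B = B.
  apply/seteqP; split=> x; rewrite /B /= expiD expi2pi -expiD addr0//.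
have mB' : measurable ((fun x : R => x + t) @^-1` B).
  by rewrite -[_ @^-1` _]setTI; apply: measurable_funD.
rewrite -[LHS]/(uniform_prob (two_pi_gt0 R)
  (@expi R @^-1` (circle_mul (expi t) @^-1` A))).
rewrite BE -[RHS]/(uniform_prob (two_pi_gt0 R) B) !uniform_probE//.
congr (_ * _)%E.
transitivity (lebesgue_measure (B `&` `[t, t + pi *+ 2[)).
  rewrite -[RHS](lebesgue_measureDr t); last exact: measurableI.
  congr (lebesgue_measure _); apply/seteqP; split=> x /=;
    by rewrite !in_itv/= lerDr [t + _]addrC ltrD2r.
rewrite (@itv_bndbnd_setU _ _ (BLeft t) (BLeft (pi *+ 2)) (BLeft (t + pi *+ 2)));
  rewrite ?bnd_simp ?lerDr//.
rewrite (@itv_bndbnd_setU _ _ (BLeft 0) (BLeft t) (BLeft (pi *+ 2)))//.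
rewrite !setIUr !measureU//; try exact: measurableI; last 2 first.
- apply/seteqP; split=> x //= -[[_ +] [_ +]].
  by rewrite !in_itv/= => /andP[_ xt] /andP[/(lt_le_trans xt)]; rewrite ltxx.
- apply/seteqP; split=> x //= -[[_ +] [_ +]].
  by rewrite !in_itv/= => /andP[_ xt] /andP[/(lt_le_trans xt)]; rewrite ltxx.
rewrite [RHS]addeC; congr (_ + _)%E.
rewrite -[LHS](lebesgue_measureDr (pi *+ 2)); last exact: measurableI.
congr (lebesgue_measure _); rewrite preimage_setI Bper; congr (_ `&` _).
by apply/seteqP; split=> x /=; rewrite !in_itv/= lerDr ltrD2r.
Qed.

Lemma measurable_circle_mul (a : circle R) : measurable_fun setT (circle_mul a).
Proof.
have [mRe mIm] := (measurable_fun_pairP _).1 (@measurable_circle_coords R).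
apply: measurable_circleP; apply/measurable_fun_pairP; split.
- have -> : fst \o (@circle_coords R \o circle_mul a) = fun z : circle R =>
      complex.Re a * complex.Re z - complex.Im a * complex.Im z.
    by apply/funext => -[[x y] z1]; case: a => -[].
  by apply: measurable_funB; apply: measurable_funM.
- have -> : snd \o (@circle_coords R \o circle_mul a) = fun z : circle R =>
      complex.Re a * complex.Im z + complex.Im a * complex.Re z.
    by apply/funext => -[[x y] z1]; case: a => -[].
  by apply: measurable_funD; apply: measurable_funM.
Qed.

Lemma measurable_torus_mul n (a : n.-tuple (circle R)) :
  measurable_fun setT (torus_mul a).
Proof.
apply/measurable_fun_tnthP => i.
have -> : (@tnth n (circle R))^~ i \o torus_mul a =
    circle_mul (tnth a i) \o (@tnth n (circle R))^~ i.
  by apply/funext => z /=; rewrite tnth_mktuple.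
apply: measurableT_comp; first exact: measurable_circle_mul.
exact: measurable_tnth.
Qed.

Lemma haarSE n (A : set (n.+1.-tuple (circle R))) :
  haar R n.+1 A = (circle_haar R \x haar R n)%E (@torus_cons R n @^-1` A).
Proof. by []. Qed.

Lemma torus_mul_cons n (a : n.+1.-tuple (circle R)) p :
  torus_mul a (torus_cons p) =
  torus_cons (circle_mul (thead a) p.1, torus_mul [tuple of behead a] p.2).
Proof.
apply: eq_from_tnth => i; rewrite tnth_mktuple.
have [j ->|->] := unliftP ord0 i; last by [].
by rewrite !tnthS/= tnth_mktuple [in LHS](tuple_eta a) tnthS.
Qed.

Lemma haarM n (a : n.-tuple (circle R)) (A : set (n.-tuple (circle R))) :
  measurable A -> haar R n (torus_mul a @^-1` A) = haar R n A.
Proof.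
elim: n a A => [|n IHn] a A mA.
  congr (haar R 0 _); apply/seteqP.
  by split=> z /=; rewrite (tuple0 z) (tuple0 (torus_mul _ _)).
rewrite !haarSE.
have := torus_mul_cons a.
move: (thead a) [tuple of behead a] => a0 a' aE.
pose f (p : circle R * n.-tuple (circle R)) :=
  (circle_mul a0 p.1, torus_mul a' p.2).
have mf : measurable_fun setT f.
  apply/measurable_fun_pairP; split.
    apply: (@measurableT_comp _ _ _ _ _ _ (circle_mul a0)) => //.
    exact: measurable_circle_mul.
  apply: (@measurableT_comp _ _ _ _ _ _ (torus_mul a')) => //.
  exact: measurable_torus_mul.
have -> : @torus_cons R n @^-1` (torus_mul a @^-1` A) =
    f @^-1` (@torus_cons R n @^-1` A).
  by apply/seteqP; split=> p /=; rewrite aE.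
have mA' : measurable (@torus_cons R n @^-1` A).
  by rewrite -[_ @^-1` _]setTI; exact: measurable_torus_cons.
move: {mA aE A} (_ @^-1` A) mA' => A mA.
have mX0 X : measurable X -> measurable (circle_mul a0 @^-1` X).
  by move=> mX; rewrite -[_ @^-1` _]setTI; exact: measurable_circle_mul.
have mY0 Y : measurable Y -> measurable (torus_mul a' @^-1` Y).
  by move=> mY; rewrite -[_ @^-1` _]setTI; exact: measurable_torus_mul.
pose mu := measure_function_pushforward__canonical__measure_function_Measure
  (circle_haar R \x haar R n)%E mf.
symmetry; apply: (product_measure_unique (m' := mu)) => // X Y mX mY.
rewrite [LHS](_ : _ = (circle_haar R \x haar R n)%E
  ((circle_mul a0 @^-1` X) `*` (torus_mul a' @^-1` Y)))//.
rewrite product_measure1E; [|exact: mX0|exact: mY0].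
by congr (_ * _)%E; [exact: circle_haarM|exact: IHn].
Qed.

End HaarInvariance.

Section MonomialMaps.
Variable R : realType.

Lemma monomial_subproof n (z : n.-tuple (circle R)) (k : 'I_n -> int) :
  `|\prod_j (tnth z j : R[i]) ^ k j| == 1.
Proof.
rewrite normr_prod big1// => j _.
by case: (k j) => m; rewrite /exprz ?normfV normrX circle_norm expr1n ?invr1.
Qed.

Definition monomial n (k : 'I_n -> int) (z : n.-tuple (circle R)) : circle R :=
  Circle (monomial_subproof z k).

Definition qmap n m (A : 'M[int]_(n, m)) (z : m.-tuple (circle R)) :
    n.-tuple (circle R) :=
  [tuple monomial (A i) z | i < n].

(* Finitely supported coefficient families: P k is the coefficient of the
   monomial with exponent vector k in Z^n. *)
Definition laurent n := {fsfun 'rV[int]_n -> R[i] with 0}.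

Definition laurent_eval n (P : laurent n) (z : n.-tuple (circle R)) : R[i] :=
  \sum_(k <- finsupp P) P k * monomial (k ord0) z.

End MonomialMaps.

Definition supnorm n (v : 'rV[int]_n) : nat := \max_(i < n) `|v ord0 i|%N.

(* k is the sup norm of some nonzero integer row vector v with v A = 0. *)
Definition height_of_relation n m (A : 'M[int]_(n, m)) : pred nat := fun k =>
  `[< exists v : 'rV[int]_n, [/\ v != 0, v *m A = 0 & supnorm v = k] >].

Definition boyd_height n m (A : 'M[int]_(n, m)) : \bar int :=
  if pselect (exists k, height_of_relation A k) is left ex
  then (ex_minn ex)%:Z%:E else +oo%E.

Section BoydLawton.
Variable R : realType.

(* Partially defined complex functions on the n-torus; None marks the points
   where the function is undefined. *)
Definition pfun n := n.-tuple (circle R) -> option R[i].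

Definition pcomp n m (g : pfun n) (A : 'M[int]_(n, m)) : pfun m :=
  fun z => g (qmap A z).

Definition cintegrable n (F : n.-tuple (circle R) -> R[i]) : Prop :=
  (haar R n).-integrable setT (fun z => (complex.Re (F z))%:E) /\
  (haar R n).-integrable setT (fun z => (complex.Im (F z))%:E).

Definition cintegral n (F : n.-tuple (circle R) -> R[i]) : R[i] :=
  Complex (\int[haar R n]_z complex.Re (F z)) (\int[haar R n]_z complex.Im (F z)).

(* F is an everywhere defined representative of the class of g in L^1. *)
Definition represents n (F : n.-tuple (circle R) -> R[i]) (g : pfun n) : Prop :=
  cintegrable F /\ {ae haar R n, forall z, g z = Some (F z)}.

Definition pintegrable n (g : pfun n) : Prop := exists F, represents F g.

Definition pintegral n (g : pfun n) : R[i] :=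
  cintegral (xget (fun=> 0) [set F | represents F g]).

Lemma pintegralE n (g : pfun n) F : represents F g -> pintegral g = cintegral F.
Proof.
move=> Fg; rewrite /pintegral; case: xgetP => [G _ Gg|/(_ F)//].
have [[/measurable_int mReF /measurable_int mImF] aeF] := Fg.
have [[/measurable_int mReG /measurable_int mImG] aeG] := Gg.
have FG : {ae haar R n, forall z, G z = F z}.
  by apply: filterS2 aeF aeG => z -> [].
congr Complex; congr fine; apply: ae_eq_integral => //.
  by apply: filterS FG => z /= -> _.
by apply: filterS FG => z /= -> _.
Qed.

(* Only the members C n with n >= 1 are constrained. The bounds M and B are
   finite, so that heights equal to +oo always exceed them. In the second
   condition a column vector r gives the map z |-> (z^r_1, ..., z^r_n) from the
   1-torus to the n-torus. *)
Definition Boyd_Lawton (C : forall n, set (pfun n)) : Prop :=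
  [/\ forall n, (1 <= n)%N -> forall g, C n g -> pintegrable g,
      forall n, (2 <= n)%N -> forall g, C n g ->
        forall eps : R, 0 < eps -> exists M : nat,
          forall r : 'cV[int]_n, (M%:Z%:E <= boyd_height r)%E ->
            pintegrable (pcomp g r) /\
            `|pintegral g - pintegral (pcomp g r)| < (eps%:C)%C &
      forall n, (1 <= n)%N -> forall g, C n g ->
        exists B : nat, forall m, (1 <= m)%N -> forall A : 'M[int]_(n, m),
          (B%:Z%:E <= boyd_height A)%E -> C m (pcomp g A)].

Definition log_abs n (P : laurent R n) : pfun n := fun z =>
  let w := laurent_eval P z in
  if w == 0 then None else Some ((ln (complex.Re `|w|))%:C)%C.

Definition C2 n : set (pfun n) :=
  [set g | exists2 P : laurent R n, P != [fsfun] & g = log_abs P].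

End BoydLawton.

(* Main.v *)
Require Import Defs.
From mathcomp Require Import all_boot all_order all_algebra.
From mathcomp Require Import all_classical all_reals all_analysis.
From mathcomp Require Import measurable_realfun complex finmap ring lra.

(** The third condition is algebra: composing with [qmap A] replaces the exponent
    [k] by [k *m A], and once the height of [A] exceeds the norms of the
    differences of the exponents of [P], distinct exponents stay distinct and no
    coefficient can cancel.

    The other two conditions amount to Lawton's theorem on Mahler measures.  Put
    [u = |P| ^ 2] and compare [ln u] with [ln (u + e)] for small [e > 0].

    For fixed [e], the function [ln (u + e)] is a uniform limit of polynomials in
    [u], that is, of trigonometric polynomials.  The integral of a trigonometric
    polynomial is its constant coefficient, which does not change under
    restriction to a one-parameter subgroup of large height.  So the integrals of
    [ln (u + e)] along [r] converge to that over the torus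
    ([Rint_ln_equidistribution]).

    What remains is that the integral of [ln (u + e) - ln u] along [r] is small
    uniformly in [r].  The degree of the restriction is unbounded, but the number
    of its monomials and the set of its coefficients are fixed, and these alone
    control the integral ([sparse_log_control]).  The proof is an induction on the
    number of monomials of a polynomial [p] with nonzero constant term and degree
    [d].  The polynomial [q = z p' / d] has one monomial less and the same leading
    coefficient, and since [1 + x y <= (1 + x) (1 + y)], it suffices to bound the
    integral of [ln (1 + s ^ 2 |q / p| ^ 2)] independently of [p]
    ([scaled_deriv_control]).  Now [q / p] is the average of the [z / (z - a)] over
    the roots [a] of [p].  Reflecting the roots in the unit circle, one dominates
    [|q / p|] by means of an average [G] of functions [1 / (1 - g z)] with
    [|g| <= 1].  These have nonnegative real part, so that
    [1 + s ^ 2 |G| ^ 2 <= |1 + s G| ^ 2]; and [1 + s G] is a quotient of two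
    polynomials without zeros in the open disc, so that the integral of
    [ln |1 + s G| ^ 2] is its value [2 ln (1 + s) <= 2 s] at the origin
    ([log_mean_value_noroot]).

    Equidistribution transports the uniform bound from the circle to the torus,
    and there monotone convergence ([ln_regularized_limit]) turns it into the
    integrability of [ln u].  The second condition follows by letting [e] tend to
    0. *)

Set Implicit Arguments.
Unset Strict Implicit.
Unset Printing Implicit Defensive.

Import Order.TTheory GRing.Theory Num.Theory.
Import numFieldNormedType.Exports.

Local Open Scope classical_set_scope.
Local Open Scope ring_scope.

(** * Integrals of real functions on a probability space *)

Section RealIntegrals.
Context d (T : measurableType d) (R : realType) (P : probability T R).
Implicit Types f g : T -> R.

Definition intg f := P.-integrable [set: T] (EFin \o f).

Lemma intg_measurable f : intg f -> measurable_fun setT f.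
Proof. by move=> /measurable_int/measurable_EFinP. Qed.

Lemma intgD f g : intg f -> intg g -> intg (fun x => f x + g x).
Proof. by move=> fi gi; exact: (integrableD measurableT fi gi). Qed.

Lemma intgB f g : intg f -> intg g -> intg (fun x => f x - g x).
Proof.
by move=> fi gi; apply: eq_integrable (integrableB measurableT fi gi).
Qed.

Lemma intgZ k f : intg f -> intg (fun x => k * f x).
Proof.
by move=> fi; apply: eq_integrable (integrableZl measurableT k fi).
Qed.

Lemma intg_cst (k : R) : intg (fun=> k).
Proof. exact: finite_measure_integrable_cst. Qed.

Lemma RintD f g : intg f -> intg g ->
  \int[P]_x (f x + g x) = \int[P]_x f x + \int[P]_x g x.
Proof. exact: RintegralD. Qed.

Lemma RintB f g : intg f -> intg g ->
  \int[P]_x (f x - g x) = \int[P]_x f x - \int[P]_x g x.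
Proof. exact: RintegralB. Qed.

Lemma RintZ k f : intg f -> \int[P]_x (k * f x) = k * \int[P]_x f x.
Proof. exact: RintegralZl. Qed.

Lemma Rint_cst (k : R) : \int[P]_x k = k.
Proof.
rewrite (Rintegral_cst P measurableT) (_ : fine _ = 1) ?mulr1//.
exact: (congr1 fine (@probability_setT _ _ _ P)).
Qed.

Lemma eq_Rint_ae f g : measurable_fun setT f -> measurable_fun setT g ->
  {ae P, forall x, f x = g x} -> \int[P]_x f x = \int[P]_x g x.
Proof.
move=> mf mg fg; congr fine; apply: ae_eq_integral => //.
- exact/measurable_EFinP.
- exact/measurable_EFinP.
- by apply: filterS fg => x /= -> _.
Qed.

Lemma ae_intg (F : T -> \bar R) g : P.-integrable setT F ->
  measurable_fun setT g -> {ae P, forall x, F x = (g x)%:E} -> intg g.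
Proof.
move=> /integrableP[mF Foo] mg Fg; apply/integrableP; split.
  exact/measurable_EFinP.
apply: le_lt_trans Foo; rewrite le_eqVlt; apply/orP; left; apply/eqP.
apply: ae_eq_integral => //.
- by apply: measurableT_comp => //; exact/measurable_EFinP.
- exact: measurableT_comp.
- by apply: filterS Fg => x /= -> _.
Qed.

Lemma le_Rint_ae f g : intg f -> intg g ->
  {ae P, forall x, f x <= g x} -> \int[P]_x f x <= \int[P]_x g x.
Proof.
move=> fi gi fg; rewrite -subr_ge0 -RintB//.
rewrite (@eq_Rint_ae _ (fun x => `|g x - f x|)).
- exact: Rintegral_ge0.
- exact/intg_measurable/intgB.
- by apply: measurableT_comp => //; exact/intg_measurable/intgB.
- by apply: filterS fg => x fg; rewrite ger0_norm// subr_ge0.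
Qed.

Lemma le_Rint f g : intg f -> intg g ->
  (forall x, f x <= g x) -> \int[P]_x f x <= \int[P]_x g x.
Proof. by move=> fi gi fg; apply: le_Rint_ae => //; exact: aeW. Qed.

Lemma Rint_dist f g (e : R) : intg f -> intg g ->
  (forall x, `|f x - g x| <= e) -> `|\int[P]_x f x - \int[P]_x g x| <= e.
Proof.
move=> fi gi fg; have ie : intg (fun=> e) by exact: intg_cst.
have H p q : intg p -> intg q -> (forall x, p x <= q x + e) ->
    \int[P]_x p x <= \int[P]_x q x + e.
  move=> ip iq pq; apply: le_trans (le_Rint ip (intgD iq ie) pq) _.
  by rewrite RintD// Rint_cst.
have fg' x : (f x <= g x + e) /\ (g x <= f x + e).
  by have := fg x; rewrite ler_norml => /andP[]; split; lra.
have := H _ _ fi gi (fun x => (fg' x).1).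
have := H _ _ gi fi (fun x => (fg' x).2).
by rewrite ler_norml; lra.
Qed.

End RealIntegrals.

Section BoundedMeasurable.
Context d (T : measurableType d) (R : realType).
Implicit Types f g : T -> R.

Definition bmeas f :=
  measurable_fun setT f /\ exists M : R, forall x, `|f x| <= M.

Lemma bmeas_intg (P : probability T R) f : bmeas f -> intg P f.
Proof.
move=> [mf [M fM]]; apply: measurable_bounded_integrable => //.
  by rewrite (@le_lt_trans _ _ 1%E)// ?probability_le1 ?ltry.
exists M; split; first exact: num_real.
by move=> x Mx y _ /=; rewrite (le_trans (fM y))// ltW.
Qed.

Lemma bmeas_cst (k : R) : bmeas (fun=> k).
Proof. by split=> //; exists `|k|. Qed.

Lemma bmeasD f g : bmeas f -> bmeas g -> bmeas (fun x => f x + g x).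
Proof.
move=> [mf [M fM]] [mg [N gN]]; split; first exact: measurable_funD.
by exists (M + N) => x; rewrite (le_trans (ler_normD _ _))// lerD.
Qed.

Lemma bmeasN f : bmeas f -> bmeas (fun x => - f x).
Proof.
move=> [mf [M fM]]; split.
  exact: measurable_funN mf.
by exists M => x; rewrite normrN.
Qed.

Lemma bmeasB f g : bmeas f -> bmeas g -> bmeas (fun x => f x - g x).
Proof. by move=> bf bg; apply: bmeasD => //; exact: bmeasN. Qed.

Lemma bmeasM f g : bmeas f -> bmeas g -> bmeas (fun x => f x * g x).
Proof.
move=> [mf [M fM]] [mg [N gN]]; split; first exact: measurable_funM.
by exists (M * N) => x; rewrite normrM ler_pM.
Qed.

Lemma bmeas_ln f (a : R) : 0 < a -> (forall x, a <= f x) -> bmeas f ->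
  bmeas (fun x => ln (f x)).
Proof.
move=> a0 af [mf [M fM]]; split.
  exact: (measurableT_comp (@measurable_ln R) mf).
exists (`|ln a| + `|ln M|) => x.
have fx0 : 0 < f x by rewrite (lt_le_trans a0).
have h1 : ln a <= ln (f x) by rewrite ler_ln ?posrE.
have h2 : ln (f x) <= ln M.
  have fxM := le_trans (ler_norm _) (fM x).
  by rewrite ler_ln ?posrE ?(lt_le_trans fx0).
rewrite ler_norml; apply/andP; split.
  have := ler_norm (- ln a); have := normr_ge0 (ln M); rewrite normrN; lra.
have := ler_norm (ln M); have := normr_ge0 (ln a); lra.
Qed.

End BoundedMeasurable.

(** * Regularized logarithms and their limit *)

Section LogLimit.
Context d (T : measurableType d) (R : realType) (P : probability T R).
Implicit Types u : T -> R.

Lemma bmeas_lnD u (e : R) : 0 < e -> (forall x, 0 <= u x) -> bmeas u ->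
  bmeas (fun x => ln (u x + e)).
Proof.
move=> e0 u0 bu; apply: (@bmeas_ln _ _ _ _ e) => //.
  by move=> x; rewrite lerDr.
by apply: bmeasD => //; exact: bmeas_cst.
Qed.

(** This is how every singular integral below is reached: [ln u] is only ever
    met as the decreasing limit of the bounded functions [ln (u + e)].  When
    [u x = 0] the difference [ln (u x + e0) - ln (u x + e)] tends to infinity,
    so that monotone convergence and a finite bound yield at the same time that
    [u] vanishes almost nowhere and that [ln u] is integrable. *)
Lemma ln_regularized_limit u (e0 eta : R) : (forall x, 0 <= u x) -> bmeas u ->
  0 < e0 ->
  (forall e, 0 < e < e0 ->
    \int[P]_x ln (u x + e0) - \int[P]_x ln (u x + e) <= eta) ->
  [/\ {ae P, forall x, 0 < u x}, intg P (fun x => ln (u x)),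
      \int[P]_x ln (u x) <= \int[P]_x ln (u x + e0) &
      \int[P]_x ln (u x + e0) - \int[P]_x ln (u x) <= eta].
Proof.
move=> u0 bu e0_gt0 H.
pose e (n : nat) : R := e0 / n.+2%:R.
have e_gt0 n : 0 < e n by rewrite divr_gt0.
have e_lt n : e n < e0.
  by rewrite ltr_pdivrMr// ltr_pMr// ltr1n.
have e_cvg : e n @[n --> \oo] --> (0 : R).
  rewrite -(mulr0 e0); apply: cvgMr.
  have := @cvg_harmonic R; rewrite -cvg_shiftS; exact.
pose h n x := ln (u x + e0) - ln (u x + e n).
have bl a : 0 < a -> bmeas (fun x => ln (u x + a)) by move=> a0; exact: bmeas_lnD.
have bh n : bmeas (h n) by apply: bmeasB; exact: bl.
have uD n x : 0 < u x + e n by rewrite ltr_wpDl.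
have h0 n x : 0 <= h n x.
  by rewrite subr_ge0 ler_ln ?posrE// ?ltr_wpDl// lerD2l ltW.
have nd_h x : {homo (fun n => (h n x)%:E) : m n / (m <= n)%N >-> (m <= n)%E}.
  move=> m n mn; rewrite lee_fin lerD2l lerN2 ler_ln ?posrE// lerD2l.
  by rewrite ler_pM2l// lef_pV2 ?posrE// ler_nat.
have mh n : measurable_fun setT (fun x => (h n x)%:E).
  by apply/measurable_EFinP; case: (bh n).
(* The limit is taken in the extended reals, where it is infinite exactly at
   the zeros of u. *)
pose F x : \bar R := limn (fun n => (h n x)%:E).
have cF x : (h n x)%:E @[n --> \oo] --> F x.
  exact: ereal_nondecreasing_is_cvgn.
have mF : measurable_fun setT F.
  by apply: emeasurable_fun_cvg mh _ => x _; exact: cF.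
have F0 x : (0 <= F x)%E.
  apply: lime_ge; first exact: ereal_nondecreasing_is_cvgn.
  by apply: nearW => n; rewrite lee_fin.
have intF : (\int[P]_x F x <= eta%:E)%E.
  rewrite (monotone_convergence P measurableT mh)//; last first.
    by move=> n x _; rewrite lee_fin.
  apply: lime_le.
    apply: ereal_nondecreasing_is_cvgn => m n mn; apply: ge0_le_integral => //.
      by move=> x _; rewrite lee_fin.
    by move=> x _; exact: nd_h.
  apply: nearW => n; have := H (e n); rewrite e_gt0 e_lt => /(_ isT).
  rewrite -RintB; [|exact/bmeas_intg/bl..].
  rewrite -lee_fin => /(le_trans _); apply.
  by rewrite /Rintegral fineK// integrable_fin_num//; exact: (bmeas_intg P (bh n)).
have iF : P.-integrable setT F.
  apply/integrableP; split=> //.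
  under eq_integral => x _ do rewrite gee0_abs//.
  by rewrite (le_lt_trans intF)// ltry.
have F_pos x : 0 < u x -> F x = (ln (u x + e0) - ln (u x))%:E.
  move=> ux; apply/cvg_lim => //; apply: cvg_EFin; first exact: nearW.
  apply: cvgB; first exact: cvg_cst.
  apply: (@cvg_comp _ _ _ (fun n => u x + e n) (@ln R) _ (nbhs (u x))); last first.
    exact: continuous_ln.
  have : u x + e n @[n --> \oo] --> u x + 0 by apply: cvgD => //; exact: cvg_cst.
  by rewrite addr0.
have F_0 x : u x = 0 -> F x = +oo%E.
  move=> ux; apply/cvg_lim => //; apply/cvgeryP; rewrite /h ux.
  apply: (@cvg_trans _ (ln e0 - ln (e n) @[n --> \oo])).
    by apply: near_eq_cvg; near=> n; rewrite !add0r.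
  apply/cvgryPge => A.
  have : \forall n \near \oo, e n < expR (ln e0 - A).
    exact: (cvgr_lt _ e_cvg _ (expR_gt0 _)).
  apply: filterS => n; rewrite -ltr_ln ?posrE ?expR_gt0// expRK; lra.
have u_pos : {ae P, forall x, 0 < u x}.
  apply: filterS (integrable_ae measurableT iF) => x /(_ I).
  by rewrite lt0r u0 andbT; apply: contraTneq => /F_0 ->.
pose g x := ln (u x + e0) - ln (u x).
have mg : measurable_fun setT g.
  apply: measurable_funB; first by case: (bl _ e0_gt0).
  by apply: (measurableT_comp (@measurable_ln R)); case: bu.
have Fg : {ae P, forall x, F x = (g x)%:E}.
  by apply: filterS u_pos => x /F_pos.
have ig : intg P g by exact: ae_intg Fg.
have bi := bmeas_intg P (bl _ e0_gt0).
have iu : intg P (fun x => ln (u x)).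
  have -> : (fun x => ln (u x)) = (fun x => ln (u x + e0) - g x).
    by apply/funext => x; rewrite /g; ring.
  exact: intgB.
split=> //.
  apply: le_Rint_ae => //; apply: filterS u_pos => x ux.
  by rewrite ler_ln ?posrE// ?addr_gt0// lerDl ltW.
rewrite -RintB// -lee_fin; apply: le_trans intF.
rewrite /Rintegral fineK; last exact: integrable_fin_num.
rewrite le_eqVlt; apply/orP; left; apply/eqP.
by apply: ae_eq_integral => //; [exact/measurable_EFinP|apply: filterS Fg => x /= -> _].
Unshelve. all: by end_near. Qed.

End LogLimit.

(** * Squared modulus and bounded measurable complex functions *)

Section SquaredModulus.
Variable R : realType.
Implicit Types x y : R[i].

Definition nsq x : R := complex.Re x ^+ 2 + complex.Im x ^+ 2.

Lemma nsq_ge0 x : 0 <= nsq x.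
Proof. by rewrite addr_ge0// sqr_ge0. Qed.

Lemma nsq_eq0 x : (nsq x == 0) = (x == 0).
Proof.
by case: x => a b; rewrite /nsq/= paddr_eq0 ?sqr_ge0// !sqrf_eq0 eq_complex.
Qed.

Lemma nsq_gt0 x : (0 < nsq x) = (x != 0).
Proof. by rewrite lt0r nsq_eq0 nsq_ge0 andbT. Qed.

Lemma nsqM x y : nsq (x * y) = nsq x * nsq y.
Proof. by case: x y => a b [c d]; rewrite /nsq/=; ring. Qed.

Lemma nsq0 : nsq 0 = 0.
Proof. by apply/eqP; rewrite nsq_eq0. Qed.

Lemma nsq1 : nsq 1 = 1.
Proof. by rewrite /nsq/= expr1n expr0n addr0. Qed.

Lemma nsqX x n : nsq (x ^+ n) = nsq x ^+ n.
Proof. by elim: n => [|n IH]; rewrite ?expr0 ?nsq1// !exprS nsqM IH. Qed.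

Lemma nsqV x : nsq x^-1 = (nsq x)^-1.
Proof.
have [->|x0] := eqVneq x 0; first by rewrite invr0 nsq0 invr0.
apply: (mulfI (_ : nsq x != 0)); first by rewrite nsq_eq0.
by rewrite -nsqM !mulfV ?nsq_eq0// nsq1.
Qed.

Lemma nsqN x : nsq (- x) = nsq x.
Proof. by case: x => a b; rewrite /nsq/= !sqrrN. Qed.

Lemma nsq_conj x : nsq (x^*)%C = nsq x.
Proof. by case: x => a b; rewrite /nsq/= sqrrN. Qed.

Lemma nsq_real (a : R) : nsq (a%:C)%C = a ^+ 2.
Proof. by rewrite /nsq/= expr0n addr0. Qed.

Lemma nsqE x : ((nsq x)%:C)%C = x * (x^*)%C.
Proof.
case: x => a b; rewrite /nsq/=; apply/eqP; rewrite eq_complex/=.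
by apply/andP; split; apply/eqP; ring.
Qed.

Lemma nsq_conjV x : nsq x = 1 -> x^-1 = (x^*)%C.
Proof.
move=> x1; have x0 : x != 0 by rewrite -nsq_gt0 x1.
by apply: (mulfI x0); rewrite mulfV// -nsqE x1.
Qed.

Lemma nsq_circle (z : circle R) : nsq z = 1.
Proof.
have := circle_norm z; rewrite normc_def => /(congr1 (@complex.Re R))/= h.
by rewrite /nsq -[LHS]sqr_sqrtr ?nsq_ge0// h expr1n.
Qed.

Lemma circle_neq0 (z : circle R) : (z : R[i]) != 0.
Proof. by rewrite -nsq_gt0 nsq_circle. Qed.

Lemma Re_normc x : complex.Re `|x| = Num.sqrt (nsq x).
Proof. by rewrite normc_def. Qed.

Lemma complex_ReD x y : complex.Re (x + y) = complex.Re x + complex.Re y.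
Proof. by case: x y => ? ? []. Qed.

Lemma complex_ImD x y : complex.Im (x + y) = complex.Im x + complex.Im y.
Proof. by case: x y => ? ? []. Qed.

Lemma complex_ReN x : complex.Re (- x) = - complex.Re x.
Proof. by case: x. Qed.

Lemma complex_ImN x : complex.Im (- x) = - complex.Im x.
Proof. by case: x. Qed.

Lemma complex_ReM x y : complex.Re (x * y) =
  complex.Re x * complex.Re y - complex.Im x * complex.Im y.
Proof. by case: x y => ? ? []. Qed.

Lemma complex_ImM x y : complex.Im (x * y) =
  complex.Re x * complex.Im y + complex.Im x * complex.Re y.
Proof. by case: x y => ? ? []. Qed.

Lemma nsq1D x : nsq (1 + x) = 1 + 2 * complex.Re x + nsq x.
Proof. by case: x => a b; rewrite /nsq/=; ring. Qed.

Lemma nsq1B x : nsq (1 - x) = 1 - 2 * complex.Re x + nsq x.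
Proof. by case: x => a b; rewrite /nsq/=; ring. Qed.

Lemma Re_le_sqrt x : complex.Re x <= Num.sqrt (nsq x).
Proof.
rewrite (le_trans (ler_norm _))// -sqrtr_sqr ler_wsqrtr// /nsq.
by rewrite lerDl sqr_ge0.
Qed.

Lemma expiX (t : R) n : (expi t : R[i]) ^+ n = expi (n%:R * t).
Proof.
elim: n => [|n IH]; first by rewrite mul0r expr0 /= cos0 sin0.
by rewrite exprS IH mulrSr mulrDl mul1r addrC [t + _]addrC expiD /= mulrC.
Qed.

Lemma expi_pi : (expi (pi : R) : R[i]) = -1.
Proof. by rewrite /= cospi sinpi; apply/eqP; rewrite eq_complex/= oppr0 !eqxx. Qed.

End SquaredModulus.

Section ComplexBoundedMeasurable.
Context d (T : measurableType d) (R : realType).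
Implicit Types f g : T -> R[i].

Definition cbmeas f :=
  bmeas (fun x => complex.Re (f x)) /\ bmeas (fun x => complex.Im (f x)).

Lemma cbmeas_cst (c : R[i]) : cbmeas (fun=> c).
Proof. by split; exact: bmeas_cst. Qed.

Lemma cbmeasD f g : cbmeas f -> cbmeas g -> cbmeas (fun x => f x + g x).
Proof.
move=> [f1 f2] [g1 g2]; split.
  by under eq_fun do rewrite complex_ReD; exact: bmeasD.
by under eq_fun do rewrite complex_ImD; exact: bmeasD.
Qed.

Lemma cbmeasN f : cbmeas f -> cbmeas (fun x => - f x).
Proof.
move=> [f1 f2]; split.
  by under eq_fun do rewrite complex_ReN; exact: bmeasN.
by under eq_fun do rewrite complex_ImN; exact: bmeasN.
Qed.

Lemma cbmeasB f g : cbmeas f -> cbmeas g -> cbmeas (fun x => f x - g x).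
Proof. by move=> bf bg; apply: cbmeasD => //; exact: cbmeasN. Qed.

Lemma cbmeasM f g : cbmeas f -> cbmeas g -> cbmeas (fun x => f x * g x).
Proof.
move=> [f1 f2] [g1 g2]; split.
  by under eq_fun do rewrite complex_ReM; apply: bmeasB; exact: bmeasM.
by under eq_fun do rewrite complex_ImM; apply: bmeasD; exact: bmeasM.
Qed.

Lemma cbmeasX f n : cbmeas f -> cbmeas (fun x => f x ^+ n).
Proof.
move=> bf; elim: n => [|n IH]; first exact: cbmeas_cst.
by under eq_fun do rewrite exprS; exact: cbmeasM.
Qed.

Lemma cbmeas_conj f : cbmeas f -> cbmeas (fun x => ((f x)^*)%C).
Proof.
move=> [f1 f2]; split.
  by have -> : (fun x => complex.Re ((f x)^*)%C) = (fun x => complex.Re (f x))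
    by apply/funext => x; case: (f x).
have -> : (fun x => complex.Im ((f x)^*)%C) = (fun x => - complex.Im (f x))
  by apply/funext => x; case: (f x).
exact: bmeasN.
Qed.

Lemma cbmeas_sum (I : Type) (s : seq I) (F : I -> T -> R[i]) :
  (forall i, cbmeas (F i)) -> cbmeas (fun x => \sum_(i <- s) F i x).
Proof.
move=> bF; elim: s => [|i s IH].
  by under eq_fun do rewrite big_nil; exact: cbmeas_cst.
by under eq_fun do rewrite big_cons; exact: cbmeasD.
Qed.

Lemma cbmeas_prod (I : Type) (s : seq I) (F : I -> T -> R[i]) :
  (forall i, cbmeas (F i)) -> cbmeas (fun x => \prod_(i <- s) F i x).
Proof.
move=> bF; elim: s => [|i s IH].
  by under eq_fun do rewrite big_nil; exact: cbmeas_cst.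
by under eq_fun do rewrite big_cons; exact: cbmeasM.
Qed.

Lemma cbmeas_horner f (p : {poly R[i]}) : cbmeas f -> cbmeas (fun x => p.[f x]).
Proof.
move=> bf; under eq_fun do rewrite horner_coef.
by apply: cbmeas_sum => i; apply: cbmeasM; [exact: cbmeas_cst|exact: cbmeasX].
Qed.

Lemma bmeas_nsq f : cbmeas f -> bmeas (fun x => nsq (f x)).
Proof. by move=> [f1 f2]; apply: bmeasD; apply: bmeasM. Qed.

End ComplexBoundedMeasurable.

Section TorusIntegrals.
Variables (R : realType) (n : nat).

Lemma cbmeas_tnth (i : 'I_n) :
  cbmeas (fun z : n.-tuple (circle R) => (tnth z i : R[i])).
Proof.
have [mRe mIm] := (measurable_fun_pairP _).1 (@measurable_circle_coords R).
have bnd (z : circle R) : `|complex.Re z| <= 1 /\ `|complex.Im z| <= 1.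
  have := nsq_circle z; rewrite /nsq => h.
  split; rewrite -sqrtr_sqr -(@sqrtr1 R) ler_wsqrtr// -h ?lerDl ?lerDr ?sqr_ge0//.
split; split; try by exists 1 => z; have [] := bnd (tnth z i).
- by apply: (measurableT_comp mRe); exact: measurable_tnth.
- by apply: (measurableT_comp mIm); exact: measurable_tnth.
Qed.

Lemma Rint_rotation (a : n.-tuple (circle R)) (f : n.-tuple (circle R) -> R) :
  bmeas f -> \int[haar R n]_z f (torus_mul a z) = \int[haar R n]_z f z.
Proof.
move=> [mf [M fM]]; congr fine.
have ma := @measurable_torus_mul R n a.
transitivity (\int[pushforward (haar R n) (torus_mul a)]_z (f z)%:E)%E.
  symmetry; rewrite integral_pushforward//.
    exact/measurable_EFinP.
  apply: (bmeas_intg (haar R n) (f := f \o torus_mul a)); split.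
    exact: (measurableT_comp mf ma).
  by exists M => x; exact: fM.
apply: eq_measure_integral => A mA _; exact: haarM.
Qed.

End TorusIntegrals.

(** * The mean value property of the logarithm on the circle *)

Section MeanValue.
Variable R : realType.
Let T1 := 1.-tuple (circle R).
Let mu := haar R 1.
Implicit Types (b : R[i]) (z : T1) (V W : {poly R[i]}).

Definition coord1 (z : 1.-tuple (circle R)) : R[i] := tnth z ord0.

Lemma cbmeas_coord1 : cbmeas coord1.
Proof. exact: cbmeas_tnth. Qed.

Lemma nsq_coord1 z : nsq (coord1 z) = 1.
Proof. exact: nsq_circle. Qed.

Lemma bmeas_nsq_horner V : bmeas (fun z => nsq V.[coord1 z]).
Proof. by apply: bmeas_nsq; apply: cbmeas_horner; exact: cbmeas_coord1. Qed.

Lemma nsq1B_ge b (s : R) : 0 <= s < 1 -> nsq b <= s ^+ 2 ->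
  (1 - s) ^+ 2 <= nsq (1 - b).
Proof.
move=> /andP[s0 s1] bs; have Rb : complex.Re b <= s.
  by rewrite (le_trans (Re_le_sqrt b))// -(ger0_norm s0) -sqrtr_sqr ler_wsqrtr.
apply: (@le_trans _ _ ((1 - complex.Re b) ^+ 2)).
  rewrite ler_pXn2r// ?nnegrE ?lerD2l ?lerN2// subr_ge0 ?(le_trans Rb)// ltW//.
have := sqr_ge0 (complex.Im b); case: b {bs Rb} => x y; rewrite /nsq/=; lra.
Qed.

Lemma nsq1B_le b : nsq b <= 1 -> nsq (1 - b) <= 4.
Proof.
move=> b1; have := nsq_ge0 (1 + b); rewrite nsq1D nsq1B; lra.
Qed.

(** Rotating by a [2 ^ k]-th root of [-1] turns [1 - x] into [1 + x] for
    [x = (b z) ^ (2 ^ k)], and [(1 - x) (1 + x) = 1 - x ^ 2]; hence the integral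
    [J k] for the exponent [2 ^ k] satisfies [J k = 2 ^ k * J 0].  All the [J k]
    are bounded by a constant depending only on the modulus of [b], so
    [J 0 = 0]. *)
Lemma Rint_ln_nsq1B_lt1 b : nsq b < 1 ->
  \int[mu]_z ln (nsq (1 - b * coord1 z)) = 0.
Proof.
move=> b1; pose s := Num.sqrt (nsq b).
have s0 : 0 <= s by exact: sqrtr_ge0.
have s2 : s ^+ 2 = nsq b by rewrite sqr_sqrtr ?nsq_ge0.
have s1 : s < 1 by rewrite -(@ltr_pXn2r _ 2) ?nnegrE// expr1n s2.
pose x k z := (b * coord1 z) ^+ (2 ^ k).
have nx k z : nsq (x k z) <= s ^+ 2.
  rewrite /x nsqX nsqM nsq_coord1 mulr1 s2.
  rewrite -[X in _ <= X]expr1 ler_wiXn2l ?nsq_ge0 ?expn_gt0// ltW//.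
have s01 : 0 <= s < 1 by rewrite s0.
have low k z : (1 - s) ^+ 2 <= nsq (1 - x k z) by exact: nsq1B_ge.
have lowD k z : (1 - s) ^+ 2 <= nsq (1 + x k z).
  by rewrite -[x k z]opprK; apply: nsq1B_ge => //; rewrite nsqN.
have s_gt0 : 0 < (1 - s) ^+ 2 by rewrite exprn_gt0// subr_gt0.
have up k z : nsq (1 - x k z) <= 4.
  by rewrite nsq1B_le// (le_trans (nx k z))// s2 ltW.
have cx k : cbmeas (x k).
  by apply: cbmeasX; apply: cbmeasM; [exact: cbmeas_cst|exact: cbmeas_coord1].
have bB k : bmeas (fun z => ln (nsq (1 - x k z))).
  apply: bmeas_ln s_gt0 (low k) _; apply: bmeas_nsq; apply: cbmeasB => //.
  exact: cbmeas_cst.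
have bD k : bmeas (fun z => ln (nsq (1 + x k z))).
  apply: bmeas_ln s_gt0 (lowD k) _; apply: bmeas_nsq; apply: cbmeasD => //.
  exact: cbmeas_cst.
pose J k := \int[mu]_z ln (nsq (1 - x k z)).
have JS k : J k.+1 = 2 * J k.
  pose a : T1 := [tuple expi (pi / (2 ^ k)%:R)].
  have rot z : x k (torus_mul a z) = - x k z.
    rewrite /x /coord1 tnth_mktuple (tnth_nth (circle_mul (expi 0) (expi 0)))/=.
    rewrite mulrCA exprMn expiX mulrCA mulfV ?mulr1; last first.
      by rewrite pnatr_eq0 expn_eq0.
    by rewrite expi_pi mulN1r.
  have JD : J k = \int[mu]_z ln (nsq (1 + x k z)).
    rewrite -(Rint_rotation a (bD k)).
    by apply: eq_Rintegral => z _; rewrite rot.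
  rewrite mulr_natl mulr2n {2}JD /J -RintD;
    [|exact/bmeas_intg/bB|exact/bmeas_intg/bD].
  apply: eq_Rintegral => z _.
  rewrite -lnM ?posrE;
    [|exact: lt_le_trans (low k z)|exact: lt_le_trans (lowD k z)].
  by rewrite -nsqM -subr_sqr expr1n /x expnSr exprM.
have JE k : J k = 2 ^+ k * J 0%N.
  by elim: k => [|k IH]; rewrite ?expr0 ?mul1r// JS IH exprS mulrA.
pose C : R := `|ln ((1 - s) ^+ 2)| + ln 4.
have JC k : `|J k| <= C.
  rewrite -[J k]subr0 -[X in _ - X](@Rint_cst _ _ _ mu 0).
  apply: Rint_dist; [exact/bmeas_intg/bB|exact: intg_cst|move=> z].
  have h1 : ln ((1 - s) ^+ 2) <= ln (nsq (1 - x k z)).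
    by rewrite ler_ln ?posrE// (lt_le_trans s_gt0).
  have h2 : ln (nsq (1 - x k z)) <= ln 4.
    by rewrite ler_ln ?posrE// (lt_le_trans s_gt0).
  have h3 : 0 <= ln 4 :> R by apply: ln_ge0; lra.
  rewrite subr0 ler_norml /C; apply/andP; split.
    by have := ler_norm (- ln ((1 - s) ^+ 2)); rewrite normrN; lra.
  by have := normr_ge0 (ln ((1 - s) ^+ 2)); lra.
have -> : \int[mu]_z ln (nsq (1 - b * coord1 z)) = J 0%N by [].
apply/eqP; rewrite -normr_eq0; apply/eqP/le_anti; rewrite normr_ge0 andbT.
apply/ler_addgt0Pl => e e0; rewrite addr0.
have C0 : 0 <= C := le_trans (normr_ge0 _) (JC 0%N).
have [k Ck] : exists k, C < 2 ^+ k * e.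
  exists (Num.bound (C / e)); rewrite -ltr_pdivrMr//.
  rewrite (lt_le_trans (archi_boundP _)) ?divr_ge0// ?ltW//.
  by rewrite -(natrX R 2) ltr_nat ltn_expl.
have := JC k; rewrite JE normrM ger0_norm ?exprn_ge0// => /le_lt_trans/(_ Ck).
by rewrite ltr_pM2l ?exprn_gt0// => /ltW.
Qed.

(** Shrinking the radius amounts to regularizing: for [b] on the unit circle,
    [1 - r b] is, up to the factor [r], the regularization of [1 - b] by
    [(1 - r) ^ 2 / r]. *)
Lemma nsq1B_dilate (r : R) b : nsq b = 1 -> 0 < r ->
  nsq (1 - (r%:C)%C * b) = r * (nsq (1 - b) + (1 - r) ^+ 2 / r).
Proof.
case: b => x y; rewrite /nsq/= => h r0.
have -> : (1 - (r * x - 0 * y)) ^+ 2 + (0 - (r * y + 0 * x)) ^+ 2 =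
  1 - 2 * r * x + r ^+ 2 * (x ^+ 2 + y ^+ 2) by ring.
have -> : (1 - x) ^+ 2 + (0 - y) ^+ 2 = 1 - 2 * x + (x ^+ 2 + y ^+ 2) by ring.
rewrite h; field; exact: lt0r_neq0.
Qed.

(** Jensen's formula for a polynomial that contributes no zeros, with the
    integrability needed to make sense of it. *)
Definition log_mean_value V :=
  [/\ {ae mu, forall z, 0 < nsq V.[coord1 z]},
      intg mu (fun z => ln (nsq V.[coord1 z])) &
      \int[mu]_z ln (nsq V.[coord1 z]) = ln (nsq V.[0])].

(** When [b] is on the unit circle, [nsq1B_dilate] shows that
    [ln (|1 - b z| ^ 2 + e)] has integral [- ln r] for [e = (1 - r) ^ 2 / r].  This
    is nonnegative and tends to 0 as [r] tends to 1, and [ln_regularized_limit]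
    carries the value over to [e = 0]. *)
Lemma log_mean_value_1BX b : nsq b <= 1 -> log_mean_value (1 - b *: 'X).
Proof.
have VE z : (1 - b *: 'X).[coord1 z] = 1 - b * coord1 z.
  by rewrite !hornerE.
have V0 : nsq (1 - b *: 'X).[0] = 1 by rewrite !hornerE subr0 nsq1.
rewrite le_eqVlt => /predU1P[b1|b1]; last first.
  pose s := Num.sqrt (nsq b).
  have s0 : 0 <= s by exact: sqrtr_ge0.
  have s2 : s ^+ 2 = nsq b by rewrite sqr_sqrtr ?nsq_ge0.
  have s1 : s < 1 by rewrite -(@ltr_pXn2r _ 2) ?nnegrE// expr1n s2.
  have low z : (1 - s) ^+ 2 <= nsq (1 - b *: 'X).[coord1 z].
    by rewrite VE nsq1B_ge ?s0// nsqM nsq_coord1 mulr1 s2.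
  have s_gt0 : 0 < (1 - s) ^+ 2 by rewrite exprn_gt0// subr_gt0.
  split.
  - by apply: aeW => z; exact: lt_le_trans (low z).
  - by apply: bmeas_intg; apply: bmeas_ln s_gt0 low _; exact: bmeas_nsq_horner.
  - rewrite V0 ln1 -(Rint_ln_nsq1B_lt1 b1).
    by apply: eq_Rintegral => z _; rewrite VE.
pose u z := nsq (1 - b *: 'X).[coord1 z].
have bu : bmeas u by exact: bmeas_nsq_horner.
have u0 z : 0 <= u z by exact: nsq_ge0.
pose e (r : R) := (1 - r) ^+ 2 / r.
have e_gt0 r : 0 < r < 1 -> 0 < e r.
  by move=> /andP[r0 r1]; rewrite divr_gt0// exprn_gt0// subr_gt0.
have int_e r : 0 < r < 1 -> \int[mu]_z ln (u z + e r) = - ln r.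
  move=> /andP[r0 r1]; have er0 : 0 < e r by rewrite e_gt0 ?r0.
  have nr : nsq ((r%:C)%C * b) < 1.
    by rewrite nsqM b1 mulr1 nsq_real expr_lt1 // ltW.
  have := Rint_ln_nsq1B_lt1 nr.
  have -> : \int[mu]_z ln (nsq (1 - (r%:C)%C * b * coord1 z)) =
            \int[mu]_z (ln r + ln (u z + e r)).
    apply: eq_Rintegral => z _.
    rewrite -mulrA nsq1B_dilate ?nsqM ?b1 ?nsq_coord1 ?mulr1//.
    by rewrite -VE lnM ?posrE// ltr_wpDl ?nsq_ge0.
  rewrite RintD; [|exact: intg_cst|exact/bmeas_intg/bmeas_lnD].
  by rewrite Rint_cst; lra.
have int_ge0 (t : R) : 0 < t -> 0 <= \int[mu]_z ln (u z + t).
  (* With r = 1 - m and m at most 1/2, (1 - r)^2 / r is at most 2 m^2,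
     hence at most m, hence at most t. *)
  move=> t0; pose m : R := Num.min t 1 / 2.
  have m0 : 0 < m by rewrite divr_gt0// lt_min t0 ltr01.
  have m12 : m <= 1 / 2 by rewrite ler_pM2r ?invr_gt0// ge_min lexx orbT.
  have mt : 2 * m <= t by rewrite /m mulrC divfK ?ge_min ?lexx// pnatr_eq0.
  have r01 : 0 < 1 - m < 1 by lra.
  have er : e (1 - m) <= t.
    rewrite /e subKr. rewrite ler_pdivrMr; last by case/andP: r01.
    nra.
  apply: (@le_trans _ _ (\int[mu]_z ln (u z + e (1 - m)))).
    by rewrite int_e// oppr_ge0 ln_le0//; lra.
  apply: le_Rint; [exact/bmeas_intg/bmeas_lnD/bu/u0/e_gt0|exact/bmeas_intg/bmeas_lnD|].
  move=> z; rewrite ler_ln ?posrE; [by rewrite lerD2l| |]; rewrite ltr_wpDl//.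
  exact: e_gt0.
have lim r : 0 < r < 1 ->
  [/\ {ae mu, forall z, 0 < u z}, intg mu (fun z => ln (u z)),
      \int[mu]_z ln (u z) <= - ln r & 0 <= \int[mu]_z ln (u z)].
  move=> r01; have H t : 0 < t < e r ->
      \int[mu]_z ln (u z + e r) - \int[mu]_z ln (u z + t) <= - ln r.
    by move=> /andP[t0 _]; rewrite int_e//; have := int_ge0 t t0; lra.
  have [h1 h2] := ln_regularized_limit u0 bu (e_gt0 _ r01) H.
  by rewrite int_e// => h3 h4; split=> //; lra.
have h12 : 0 < (1 / 2 : R) < 1 by lra.
have [h1 h2 _ h4] := lim _ h12.
split=> //; rewrite V0 ln1; apply: le_anti; rewrite h4 andbT leNgt; apply/negP.
set I := \int[mu]_z _ => I0.
have := lim (expR (- (I / 2))); rewrite expR_gt0 -[X in _ < X]expR0 ltr_expR.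
rewrite oppr_lt0 divr_gt0// => /(_ isT) [_ _ + _]; rewrite expRK -/I; lra.
Qed.

Lemma log_mean_valueC (c : R[i]) : c != 0 -> log_mean_value c%:P.
Proof.
move=> c0; split.
- by apply: aeW => z; rewrite hornerC nsq_gt0.
- by under eq_fun do rewrite hornerC; exact: intg_cst.
- by under eq_Rintegral do rewrite hornerC; rewrite Rint_cst hornerC.
Qed.

Lemma log_mean_valueM V W : V.[0] != 0 -> W.[0] != 0 ->
  log_mean_value V -> log_mean_value W -> log_mean_value (V * W).
Proof.
move=> V0 W0 [aeV iV IV] [aeW iW IW].
have ae : {ae mu, forall z, ln (nsq (V * W).[coord1 z]) =
    ln (nsq V.[coord1 z]) + ln (nsq W.[coord1 z])}.
  by apply: filterS2 aeV aeW => z Vz Wz; rewrite hornerM nsqM lnM.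
have mVW : measurable_fun setT (fun z => ln (nsq (V * W).[coord1 z])).
  apply: (measurableT_comp (@measurable_ln R)).
  by have [] := bmeas_nsq_horner (V * W).
have iD := intgD iV iW.
split.
- by apply: filterS2 aeV aeW => z Vz Wz; rewrite hornerM nsqM mulr_gt0.
- by apply: (ae_intg iD mVW); apply: filterS ae => z /= ->.
- rewrite (eq_Rint_ae _ _ ae)//; last exact: intg_measurable iD.
  by rewrite RintD// IV IW hornerM nsqM lnM ?posrE ?nsq_gt0.
Qed.

Lemma log_mean_value_noroot V : (forall w, nsq w < 1 -> V.[w] != 0) ->
  log_mean_value V.
Proof.
move=> nr; have V0 : V.[0] != 0 by rewrite nr// nsq0 ltr01.
have VN0 : V != 0 by apply: contraNneq V0 => ->; rewrite horner0.
have [rs Vrs] := closed_field_poly_normal V.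
have rs1 a : a \in rs -> 1 <= nsq a.
  move=> ars; rewrite leNgt; apply/negP => /nr /negP; apply.
  rewrite Vrs hornerZ horner_prod mulf_eq0; apply/orP; right.
  by rewrite prodf_seq_eq0; apply/hasP; exists a => //=; rewrite !hornerE subrr.
move: {nr V0} (lead_coef V) Vrs (VN0) => c -> {VN0}.
rewrite -lead_coef_eq0 lead_coefZ => cN0.
have {cN0} c0 : c != 0 by apply: contraNneq cN0 => ->; rewrite mul0r.
rewrite -mul_polyC.
have [] : (\prod_(a <- rs) ('X - a%:P)).[0] != 0 /\
    log_mean_value (\prod_(a <- rs) ('X - a%:P)); last first.
  by move=> h1 h2; apply: log_mean_valueM => //; rewrite ?hornerC//; exact: log_mean_valueC.
elim: rs rs1 => [_|a rs IH rs1].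
  by rewrite big_nil hornerE oner_eq0; split=> //; exact/log_mean_valueC/oner_neq0.
have [|h1 h2] := IH; first by move=> x xrs; rewrite rs1// in_cons xrs orbT.
have a1 : 1 <= nsq a by rewrite rs1// mem_head.
have a0 : a != 0 by rewrite -nsq_gt0 (lt_le_trans ltr01).
rewrite big_cons; have -> : 'X - a%:P = (- a)%:P * (1 - a^-1 *: 'X).
  rewrite mulrBr mulr1 -mul_polyC mulrA -polyCM mulNr mulfV//.
  by rewrite !polyCN polyC1 mulN1r opprK addrC.
have na0 : (- a)%:P.[0] != 0 by rewrite hornerC oppr_eq0.
have n10 : (1 - a^-1 *: 'X).[0] != 0 by rewrite !hornerE subr0 oner_eq0.
have nP : ((- a)%:P * (1 - a^-1 *: 'X)).[0] != 0 by rewrite hornerM mulf_neq0.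
split; first by rewrite hornerM mulf_neq0.
apply: log_mean_valueM => //; apply: log_mean_valueM => //.
  by apply: log_mean_valueC; rewrite oppr_eq0.
by apply: log_mean_value_1BX; rewrite nsqV invf_le1 // (lt_le_trans ltr01).
Qed.

End MeanValue.

(** * Logarithmic derivatives and sparse polynomials *)

Section LogDerivative.
Variable R : realType.
Implicit Types (a w : R[i]) (rs : seq R[i]) (p : {poly R[i]}).

(** If [a] is in the closed disc, the conjugate of [z / (z - a)] on the unit
    circle is [1 / (1 - conj(a) z)]; otherwise [z / (z - a) = 1 - 1 / (1 - z / a)].
    The parameter [reflect_in a] unifies both cases: it is always in the closed
    disc, so [1 / (1 - reflect_in a * z)] has nonnegative real part there. *)
Definition reflect_in a : R[i] := if nsq a <= 1 then (a^*)%C else a^-1.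

Lemma nsq_reflect_in a : nsq (reflect_in a) <= 1.
Proof.
rewrite /reflect_in; case: ifPn => [a1|]; first by rewrite nsq_conj.
by rewrite -ltNge => a1; rewrite nsqV invf_le1 ?ltW// (lt_trans ltr01).
Qed.

Definition poly_of_roots rs : {poly R[i]} := \prod_(a <- rs) ('X - a%:P).
Definition reflected_poly rs : {poly R[i]} := \prod_(a <- rs) (1 - reflect_in a *: 'X).

Definition dlog rs w := \sum_(a <- rs) w / (w - a).
Definition dlog_refl rs w := \sum_(a <- rs) (1 - reflect_in a * w)^-1.

Lemma poly_of_roots_dlog rs w : (poly_of_roots rs).[w] != 0 ->
  w * (poly_of_roots rs)^`().[w] = (poly_of_roots rs).[w] * dlog rs w.
Proof.
rewrite /poly_of_roots /dlog; elim: rs => [|a rs IH].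
  by rewrite !big_nil derivC horner0 !mulr0.
rewrite !big_cons hornerM hornerXsubC mulf_eq0 negb_or => /andP[wa P0].
rewrite derivM derivXsubC hornerD !hornerM hornerXsubC hornerC mulrDr mul1r.
by rewrite [w * (_ * _)]mulrCA IH// mulrDr; field.
Qed.

Lemma reflected_poly_dlog rs w : (reflected_poly rs).[w] != 0 ->
  (size rs)%:R * (reflected_poly rs).[w] - w * (reflected_poly rs)^`().[w] =
  (reflected_poly rs).[w] * dlog_refl rs w.
Proof.
rewrite /reflected_poly /dlog_refl; elim: rs => [|a rs IH].
  by rewrite !big_nil derivC horner0 mulr0 mul0r subr0 mulr0.
have hE : (1 - reflect_in a *: 'X).[w] = 1 - reflect_in a * w by rewrite !hornerE.
have dE : (1 - reflect_in a *: 'X)^`().[w] = - reflect_in a.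
  by rewrite derivB derivZ derivX derivC sub0r hornerN hornerZ hornerC mulr1.
rewrite !big_cons hornerM hE mulf_eq0 negb_or => /andP[wa P0].
move: {IH P0} (IH P0); rewrite derivM hornerD !hornerM dE hE /=.
set P := \prod_(b <- rs) (1 - reflect_in b *: 'X).
set S := \sum_(b <- rs) (1 - reflect_in b * w)^-1.
set A := P.[w]; set A' := P^`().[w] => IH; rewrite mulrDr.
transitivity ((1 - reflect_in a * w) * ((size rs)%:R * A - w * A') + A).
  by rewrite -[(size rs).+1]addn1 natrD; ring.
by rewrite IH; field.
Qed.

Lemma Re_inv1B_ge0 (x : R[i]) : nsq x <= 1 -> 0 <= complex.Re (1 - x)^-1.
Proof.
move=> x1; have : 0 <= complex.Re (1 - x).
  rewrite complex_ReD complex_ReN subr_ge0 (le_trans (Re_le_sqrt x))//.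
  by rewrite -[leRHS](@sqrtr1 R) ler_wsqrtr.
by case: (1 - x) => u v /= u0; rewrite divr_ge0// addr_ge0 ?sqr_ge0.
Qed.

Lemma dlog_term a w : nsq w = 1 -> w - a != 0 -> 1 - reflect_in a * w != 0 ->
  complex.Im (w / (w - a)) = - complex.Im (1 - reflect_in a * w)^-1 /\
  `|complex.Re (w / (w - a))| <= 1 + complex.Re (1 - reflect_in a * w)^-1.
Proof.
move=> w1 wa; have w0 : w != 0 by rewrite -nsq_gt0 w1.
have : 0 <= complex.Re (1 - reflect_in a * w)^-1.
  by apply: Re_inv1B_ge0; rewrite nsqM w1 mulr1 nsq_reflect_in.
rewrite /reflect_in; case: ifPn => [a1|]; last first.
  rewrite -ltNge => a1.
  have a0 : a != 0 by rewrite -nsq_gt0 (lt_trans ltr01).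
  have -> : 1 - a^-1 * w = a^-1 * (a - w) by rewrite mulrBr mulVf.
  move=> + n0.
  have aw : a - w != 0 by rewrite -opprB oppr_eq0.
  have -> : w / (w - a) = 1 - (a^-1 * (a - w))^-1.
    by rewrite invfM invrK; field; rewrite aw wa.
  rewrite complex_ReD complex_ReN complex_ImD complex_ImN /= => h; split; first by rewrite add0r.
  by rewrite ler_norml; lra.
move=> + n0.
have -> : w / (w - a) = (((1 - (a^*)%C * w)^-1)^*)%C.
  rewrite conjc_inv rmorphB rmorph1 rmorphM /= conjcK -(nsq_conjV w1).
  by field; rewrite w0 wa.
by case: (_^-1) => x y /= x0; split=> //; rewrite ler_norml; lra.
Qed.

(** Replacing each root by its reflection only conjugates the terms of the
    logarithmic derivative, up to adding 1 and changing a sign.  As the reflected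
    terms have nonnegative real parts, the reflected sum controls the modulus of
    the original one without any cancellation. *)
Lemma dlog_bound rs w : nsq w = 1 -> (poly_of_roots rs).[w] != 0 ->
  (reflected_poly rs).[w] != 0 ->
  complex.Im (dlog rs w) = - complex.Im (dlog_refl rs w) /\
  `|complex.Re (dlog rs w)| <= (size rs)%:R + complex.Re (dlog_refl rs w).
Proof.
move=> w1; rewrite /poly_of_roots /reflected_poly /dlog /dlog_refl.
elim: rs => [|a rs IH]; first by rewrite !big_nil/= oppr0 normr0 addr0.
rewrite !big_cons !hornerM !hornerE !mulf_eq0 !negb_or => /andP[wa P0] /andP[ga A0].
have [IH1 IH2] := IH P0 A0; have [h1 h2] := dlog_term w1 wa ga.
rewrite !complex_ReD !complex_ImD IH1 h1 -opprD; split=> //.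
rewrite (le_trans (ler_normD _ _))// -[X in X%:R]add1n natrD; lra.
Qed.

Lemma Re_dlog_refl_ge0 rs w : nsq w <= 1 -> 0 <= complex.Re (dlog_refl rs w).
Proof.
move=> w1; rewrite /dlog_refl; elim: rs => [|a rs IH]; first by rewrite big_nil.
rewrite big_cons complex_ReD addr_ge0// Re_inv1B_ge0// nsqM.
by rewrite mulr_ile1 ?nsq_ge0 ?nsq_reflect_in.
Qed.

Lemma reflected_poly_neq0 rs w : nsq w < 1 -> (reflected_poly rs).[w] != 0.
Proof.
move=> w1; rewrite /reflected_poly; elim: rs => [|a rs IH].
  by rewrite big_nil hornerC oner_eq0.
rewrite big_cons hornerM mulf_neq0// !hornerE subr_eq0; apply/eqP => /(congr1 (@nsq R)).
rewrite nsq1 nsqM => h; have := nsq_reflect_in a; have := nsq_ge0 (reflect_in a).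
have := nsq_ge0 w; nra.
Qed.

Lemma poly_of_roots_neq0 rs w : nsq w = 1 -> (reflected_poly rs).[w] != 0 ->
  (poly_of_roots rs).[w] != 0.
Proof.
move=> w1; rewrite /reflected_poly /poly_of_roots; elim: rs => [|a rs IH].
  by rewrite !big_nil hornerC oner_eq0.
rewrite !big_cons !hornerM !hornerE !mulf_eq0 !negb_or => /andP[h /IH ->].
rewrite andbT; apply: contraNneq h => /eqP; rewrite subr_eq0 => /eqP <-.
by rewrite /reflect_in w1 lexx mulrC -nsqE w1 subrr.
Qed.

(** Dividing Euler's operator by the degree keeps the leading coefficient, while
    the constant term still disappears. *)
Definition scaled_deriv p : {poly R[i]} := ((size p).-1%:R)^-1 *: ('X * p^`()).

(** The analytic heart: the quotient of [scaled_deriv p] by [p] is logarithmically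
    small on average, uniformly in [p].  With [G] the average of the reflected
    terms, [|q / p| ^ 2 <= 2 + 2 |G| ^ 2] by [dlog_bound], and since [Re G >= 0],
    [1 + s ^ 2 |G| ^ 2 <= |1 + s G| ^ 2].  Now [1 + s G] is a quotient [V / A] of
    polynomials without zeros in the open disc and takes the value [1 + s] at 0,
    so the mean value property evaluates the integral of its logarithm. *)
Lemma scaled_deriv_control p (s : R) : (1 < size p)%N -> 0 < s ->
  exists H : 1.-tuple (circle R) -> R,
  [/\ intg (haar R 1) H, \int[haar R 1]_z H z <= 2 * s &
  {ae haar R 1, forall z, exists2 N, 0 <= N &
    [/\ 0 < nsq p.[coord1 z],
        nsq (scaled_deriv p).[coord1 z] <= (2 + 2 * N) * nsq p.[coord1 z] &
        ln (1 + s ^+ 2 * N) <= H z]}].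
Proof.
move=> sp s0; have [rs prs] := closed_field_poly_normal p.
have p0 : p != 0 by rewrite -size_poly_gt0 (ltn_trans _ sp).
have c0 : lead_coef p != 0 by rewrite lead_coef_eq0.
have prs' : p = lead_coef p *: poly_of_roots rs by [].
have size_rs : size rs = (size p).-1.
  by rewrite prs' size_scale// size_prod_XsubC.
have d0 : 0 < (size rs)%:R :> R by rewrite ltr0n size_rs -ltnS prednK// ltnW.
set d : R := (size rs)%:R in d0.
have dE : (size rs)%:R = (d%:C)%C :> R[i] by rewrite /d rmorph_nat.
have dC0 : (d%:C)%C != 0 :> R[i] by rewrite -dE pnatr_eq0 -(pnatr_eq0 R) gt_eqF.
pose A := reflected_poly rs.
(* V = A (1 + s G), written as a polynomial through reflected_poly_dlog. *)
pose V := A + ((s / d)%:C)%C *: ((d%:C)%C *: A - 'X * A^`()).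
pose G w := ((d^-1)%:C)%C * dlog_refl rs w.
have VE w : A.[w] != 0 -> V.[w] = A.[w] * (1 + (s%:C)%C * G w).
  move=> /reflected_poly_dlog; rewrite dE => h.
  rewrite /V !(hornerE, hornerZ, hornerD, hornerM, hornerN) -/A h /G.
  rewrite rmorphM /=; ring.
have ReG w : nsq w <= 1 -> 0 <= complex.Re (G w).
  move=> w1; rewrite /G complex_ReM /= mul0r subr0.
  by apply: mulr_ge0; [rewrite invr_ge0 ltW|exact: Re_dlog_refl_ge0].
have nG w : nsq w <= 1 -> 1 + s ^+ 2 * nsq (G w) <= nsq (1 + (s%:C)%C * G w).
  move=> w1; rewrite nsq1D nsqM nsq_real lerD2r lerDl complex_ReM /= mul0r subr0.
  by rewrite !mulr_ge0 ?ReG// ltW.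
have A_neq0 w : nsq w < 1 -> A.[w] != 0 by exact: reflected_poly_neq0.
have V_neq0 w : nsq w < 1 -> V.[w] != 0.
  move=> w1; rewrite VE ?A_neq0// mulf_neq0 ?A_neq0// -nsq_gt0.
  rewrite (lt_le_trans _ (nG w (ltW w1)))// ltr_pwDl// mulr_ge0 ?nsq_ge0//.
  exact: sqr_ge0.
have [Aae Ai AI] := log_mean_value_noroot A_neq0.
have [Vae Vi VI] := log_mean_value_noroot V_neq0.
have A0 : A.[0] = 1.
  rewrite /A /reflected_poly horner_prod big1// => a _.
  by rewrite !hornerE subr0.
have V0 : V.[0] = ((1 + s)%:C)%C.
  rewrite /V hornerD hornerZ hornerD hornerN hornerZ hornerM hornerX A0.
  by rewrite mul0r subr0 mulr1 -rmorphM divfK ?gt_eqF// rmorphD rmorph1.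
exists (fun z => ln (nsq V.[coord1 z]) - ln (nsq A.[coord1 z])); split.
- exact: intgB.
- rewrite RintB// VI AI A0 V0 nsq1 ln1 subr0 nsq_real lnXn; last lra.
  by rewrite -[X in X <= _]mulr_natl ler_pM2l// le_ln1Dx//; lra.
apply: filterS2 Aae Vae => z Az Vz; have w1 := nsq_coord1 z.
move: (coord1 z) w1 Az Vz => w w1 Aw Vw.
have Aw0 : A.[w] != 0 by rewrite -nsq_gt0.
have rw0 := poly_of_roots_neq0 w1 Aw0.
exists (nsq (G w)); first exact: nsq_ge0.
split.
- by rewrite prs' hornerZ nsqM mulr_gt0// nsq_gt0.
- have := poly_of_roots_dlog rw0; set S := dlog rs w => hS.
  have -> : (scaled_deriv p).[w] = p.[w] * (((d^-1)%:C)%C * S).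
    rewrite /scaled_deriv -size_rs dE hornerZ hornerM hornerX.
    rewrite [in p^`()]prs' derivZ hornerZ [in p.[w]]prs' hornerZ.
    by rewrite [w * _]mulrCA hS fmorphV; ring.
  rewrite nsqM mulrC ler_wpM2r ?nsq_ge0// /G !nsqM.
  have [h1 h2] := dlog_bound w1 rw0 Aw0.
  have h3 : 0 <= complex.Re (dlog_refl rs w).
    by apply: Re_dlog_refl_ge0; rewrite w1.
  rewrite nsq_real -/d in h2 *.
  have h4 : nsq S <= 2 * d ^+ 2 + 2 * nsq (dlog_refl rs w).
    rewrite /nsq h1 sqrrN.
    have : complex.Re (dlog rs w) ^+ 2 <= (d + complex.Re (dlog_refl rs w)) ^+ 2.
      by rewrite -ler_sqrt ?sqr_ge0// !sqrtr_sqr [leRHS]ger0_norm// addr_ge0// ltW.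
    have := sqr_ge0 (complex.Im (dlog_refl rs w)).
    have := sqr_ge0 (d - complex.Re (dlog_refl rs w)); nra.
  have -> : 2 + 2 * (d^-1 ^+ 2 * nsq (dlog_refl rs w)) =
            d^-1 ^+ 2 * (2 * d ^+ 2 + 2 * nsq (dlog_refl rs w)).
    by field; rewrite gt_eqF.
  by rewrite ler_wpM2l// sqr_ge0.
- have -> : nsq V.[w] = nsq A.[w] * nsq (1 + (s%:C)%C * G w) by rewrite VE// nsqM.
  have G1 : 0 < 1 + s ^+ 2 * nsq (G w).
    by rewrite ltr_pwDl// mulr_ge0 ?nsq_ge0// sqr_ge0.
  have G2 := nG w; rewrite w1 lexx in G2; have {}G2 := G2 isT.
  have G3 := lt_le_trans G1 G2.
  by rewrite lnM ?posrE// [leRHS]addrC addKr ler_ln ?posrE.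
Qed.

Definition nterms p : nat := \sum_(i < size p) (p`_i != 0)%R.

Lemma coef_scaled_deriv p i :
  (scaled_deriv p)`_i = p`_i *+ i / (size p).-1%:R.
Proof.
rewrite /scaled_deriv coefZ mulrC coefXM; case: i => [|i] //=.
by rewrite coef_deriv.
Qed.

Lemma size_scaled_deriv p : (1 < size p)%N -> size (scaled_deriv p) = size p.
Proof.
move=> sp; pose E i := p`_i *+ i / (size p).-1%:R.
have d0 : (0 < (size p).-1)%N by rewrite -ltnS prednK// ltnW.
have -> : scaled_deriv p = \poly_(i < size p) E i.
  apply/polyP => i; rewrite coef_poly coef_scaled_deriv; case: ltnP => // pi.
  by rewrite nth_default// mul0rn mul0r.
apply: size_poly_eq; rewrite /E -[_ *+ _ in X in X / _]mulr_natr mulfK ?pnatr_eq0 -?lt0n//.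
by rewrite -lead_coefE lead_coef_eq0 -size_poly_gt0 ltnW.
Qed.

Lemma lead_coef_scaled_deriv p : (1 < size p)%N ->
  lead_coef (scaled_deriv p) = lead_coef p.
Proof.
move=> sp; rewrite lead_coefE size_scaled_deriv// coef_scaled_deriv.
rewrite -[_ *+ _ in X in X / _]mulr_natr mulfK// pnatr_eq0 -lt0n -ltnS prednK// ltnW//.
Qed.

Lemma nterms_scaled_deriv p : (1 < size p)%N -> p`_0 != 0 ->
  nterms p = (nterms (scaled_deriv p)).+1.
Proof.
move=> sp p0; rewrite /nterms size_scaled_deriv//.
case E : (size p) sp => [//|k] sp; rewrite !big_ord_recl/= p0.
rewrite coef_scaled_deriv mulr0n mul0r eqxx add0n add1n; congr _.+1.
apply: eq_bigr => i _; rewrite coef_scaled_deriv E /= /bump /= add1n.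
by rewrite -(mulr_natr (p`_ _)) -mulrA mulf_eq0 negb_or mulf_neq0 ?andbT// ?invr_eq0
  ?pnatr_eq0// -lt0n -ltnS.
Qed.

Lemma nterms_mulX p : p != 0 -> nterms (p * 'X) = nterms p.
Proof.
move=> p0; rewrite /nterms size_mulX// big_ord_recl coefMX eqxx add0n.
by apply: eq_bigr => i _; rewrite coefMX.
Qed.

Lemma lead_coef_mulX p : lead_coef (p * 'X) = lead_coef p.
Proof. by rewrite lead_coefM lead_coefX mulr1. Qed.

(** The inductive inequality, with [U = |p| ^ 2] and [Q = |q| ^ 2].  It follows
    from [1 + x y <= (1 + x) (1 + y)] by factoring the ratio [e0 / (U + e)] through
    [Q + t], where [t] is the regularization used for [q]. *)
Lemma log_ratio_split (U Q N k e0 e1 e : R) :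
  0 < U -> 0 <= Q -> 0 <= N -> Q <= (2 + 2 * N) * U ->
  0 < k -> 0 < e0 -> 0 < e1 -> e0 <= k * (e1 / 2) -> 0 < e ->
  ln (U + e0) - ln (U + e) <=
  ln (Q + e1) - ln (Q + Num.min e (e1 / 2)) + (3 * k + ln (1 + 2 * k * N)).
Proof.
move=> U0 Q0 N0 QU k0 e00 e10 e01 e_gt0.
set t := Num.min e (e1 / 2).
have e12 : 0 < e1 / 2 by rewrite divr_gt0.
have t0 : 0 < t by rewrite lt_min e_gt0.
have te : t <= e by rewrite ge_min lexx.
have te1 : t <= e1 / 2 by rewrite ge_min lexx orbT.
have kN : 0 <= k * N by rewrite mulr_ge0// ltW.
have h3 : ln (1 + 3 * k) <= 3 * k by rewrite le_ln1Dx//; lra.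
suff : ln (U + e0) + ln (Q + t) <=
    ln (U + e) + (ln (Q + e1) + (ln (1 + 3 * k) + ln (1 + 2 * k * N))) by lra.
have Ue0 : 0 < U + e0 by lra.
have Ue : 0 < U + e by lra.
have Qt : 0 < Q + t by lra.
have Qe : 0 < Q + e1 by lra.
have k3 : 0 < 1 + 3 * k by lra.
have kN2 : 0 < 1 + 2 * k * N by lra.
rewrite -!lnM ?posrE ?mulr_gt0// ler_ln ?posrE ?mulr_gt0//.
have QtU : Q + t <= (3 + 2 * N) * (U + e).
  have Ne : 0 <= N * e by rewrite mulr_ge0// ltW.
  have NU : 0 <= N * U by rewrite mulr_ge0// ltW.
  lra.
have kN3 : 1 + k * (3 + 2 * N) <= (1 + 3 * k) * (1 + 2 * k * N) by nra.
apply: (@le_trans _ _ ((U + e) * ((Q + t + e1 / 2) * (1 + k * (3 + 2 * N))))).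
  apply: (@le_trans _ _ ((U + e) * (Q + t) + k * (e1 / 2) * (Q + t))).
    by rewrite -mulrDl ler_wpM2r ?(ltW Qt)//; lra.
  have : k * (e1 / 2) * (Q + t) <= k * (e1 / 2) * ((3 + 2 * N) * (U + e)).
    by rewrite ler_wpM2l// ltW// mulr_gt0.
  have : 0 <= (U + e) * (e1 / 2) by rewrite ltW// mulr_gt0.
  have : 0 <= (U + e) * (Q + t) * (k * (3 + 2 * N)).
    by rewrite !mulr_ge0 ?(ltW Ue) ?(ltW Qt) ?(ltW k0)//; lra.
  lra.
rewrite ler_wpM2l ?(ltW Ue)// ler_pM//; lra.
Qed.

End LogDerivative.

Section SparsePolynomials.
Variable R : realType.

(** The constant [e0] depends on the number of monomials and on the size of the
    leading coefficient, but not on the degree: this is what makes the estimate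
    uniform over all restrictions of one Laurent polynomial to one-parameter
    subgroups.  Induction on the number of monomials: after division by a power
    of [z] the constant term is nonzero, and [scaled_deriv] removes it. *)
Lemma sparse_log_control (K : nat) (c eta : R) : 0 < c -> 0 < eta ->
  exists2 e0 : R, 0 < e0 & forall p : {poly R[i]}, (nterms p <= K)%N ->
    c <= nsq (lead_coef p) -> forall e : R, 0 < e < e0 ->
    \int[haar R 1]_z ln (nsq p.[coord1 z] + e0) -
    \int[haar R 1]_z ln (nsq p.[coord1 z] + e) <= eta.
Proof.
move=> c0; elim: K eta => [|K IH] eta eta0.
  exists 1 => // p; rewrite leqn0 sum_nat_eq0 => /forallP p0 cp.
  have p_neq0 : p != 0.
    by rewrite -lead_coef_eq0 -nsq_gt0 (lt_le_trans c0).
  have sp : (0 < size p)%N by rewrite size_poly_gt0.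
  have pn : ((size p).-1 < size p)%N by rewrite prednK.
  have := p0 (Ordinal pn); rewrite /= -lead_coefE lead_coef_eq0.
  by rewrite p_neq0.
have eta2 : 0 < eta / 2 by rewrite divr_gt0.
have [e1 e10 He1] := IH _ eta2.
(* The step costs 3 k + 2 s with k = s^2 / 2 and s <= 1, hence at most 4 s,
   which has to fit into the other half of eta. *)
pose s : R := Num.min 1 (eta / 8).
have s0 : 0 < s by rewrite lt_min ltr01 divr_gt0.
have s1 : s <= 1 by rewrite ge_min lexx.
have s8 : s <= eta / 8 by rewrite ge_min lexx orbT.
pose k : R := s ^+ 2 / 2.
have k0 : 0 < k by rewrite divr_gt0// exprn_gt0.
have e12 : 0 < e1 / 2 by rewrite divr_gt0.
(* The second bound serves the constant polynomials. *)
exists (Num.min (k * (e1 / 2)) (c * eta)); first by rewrite lt_min !mulr_gt0.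
set e0 := Num.min _ _.
have e00 : 0 < e0 by rewrite lt_min !mulr_gt0.
have e0k : e0 <= k * (e1 / 2) by rewrite ge_min lexx.
have e0c : e0 <= c * eta by rewrite ge_min lexx orbT.
move=> p; have [m] := ubnP (size p); elim: m p => // m IHm p.
rewrite ltnS => pm pK cp e /andP[e_gt0 ee0].
have p_neq0 : p != 0 by rewrite -lead_coef_eq0 -nsq_gt0 (lt_le_trans c0).
have lnp (q : {poly R[i]}) (x : R) : 0 < x ->
    intg (haar R 1) (fun z => ln (nsq q.[coord1 z] + x)).
  move=> x0; apply/bmeas_intg/bmeas_lnD => //; last exact: bmeas_nsq_horner.
  by move=> z; exact: nsq_ge0.
have [p00|p00] := eqVneq p`_0 0.
  have [p1 pE] : exists p1, p = p1 * 'X.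
    by have /factor_theorem[q ->] : root p 0;
      [rewrite /root horner_coef0 p00|exists q; rewrite subr0].
  have p10 : p1 != 0 by apply: contraNneq p_neq0 => p10; rewrite pE p10 mul0r.
  have sp1 : (size p1 < m)%N by rewrite (leq_trans _ pm)// pE size_mulX.
  have := IHm p1 sp1; rewrite -(nterms_mulX p10) -(lead_coef_mulX p1) -pE.
  move=> /(_ pK cp e); rewrite e_gt0 ee0 => /(_ isT); congr (_ - _ <= _);
    by apply: eq_Rintegral => z _; rewrite pE hornerMX nsqM nsq_coord1 mulr1.
have [sp|sp] := leqP (size p) 1.
  rewrite (size1_polyC sp) in cp *; rewrite lead_coefC in cp.
  set U := nsq _ in cp; have U0 : 0 < U by rewrite (lt_le_trans c0).
  under eq_Rintegral do rewrite hornerC -/U.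
  under [X in _ - X]eq_Rintegral do rewrite hornerC -/U.
  have Ue : 0 < U + e by lra.
  have Ue0 : 0 < U + e0 by lra.
  rewrite !Rint_cst -ln_div ?posrE//.
  have -> : (U + e0) / (U + e) = 1 + (e0 - e) / (U + e).
    by field; rewrite gt_eqF.
  have h : 0 <= (e0 - e) / (U + e) by rewrite divr_ge0// ?subr_ge0 ltW.
  have h1 : (e0 - e) / (U + e) <= eta by rewrite ler_pdivrMr//; nra.
  by apply: le_trans h1; apply: le_ln1Dx; lra.
pose q := scaled_deriv p.
have sq : (nterms q <= K)%N by rewrite -ltnS /q -(nterms_scaled_deriv sp p00).
have cq : c <= nsq (lead_coef q) by rewrite lead_coef_scaled_deriv.
pose t := Num.min e (e1 / 2).
have t0 : 0 < t by rewrite lt_min e_gt0.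
have te1 : t <= e1 / 2 by rewrite ge_min lexx orbT.
have := He1 q sq cq t; rewrite t0 => /(_ _) Hq.
have {}Hq : \int[haar R 1]_z ln (nsq q.[coord1 z] + e1) -
  \int[haar R 1]_z ln (nsq q.[coord1 z] + t) <= eta / 2 by apply: Hq; lra.
have [H [iH HI Hae]] := scaled_deriv_control sp s0.
rewrite -RintB; [|exact: lnp..].
rewrite -RintB in Hq; [|exact: lnp..].
have ik : intg (haar R 1) (fun z => 3 * k + H z) by apply: intgD => //; exact: intg_cst.
have iq : intg (haar R 1) (fun z => ln (nsq q.[coord1 z] + e1) - ln (nsq q.[coord1 z] + t)).
  by apply: intgB; exact: lnp.
apply: (@le_trans _ _ (\int[haar R 1]_z ((ln (nsq q.[coord1 z] + e1) -
    ln (nsq q.[coord1 z] + t)) + (3 * k + H z)))).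
  apply: le_Rint_ae.
  - by apply: intgB; exact: lnp.
  - exact: intgD.
  apply: filterS Hae => z [N N0 [h1 h2 h3]].
  apply: le_trans (log_ratio_split h1 (nsq_ge0 _) N0 h2 k0 e00 e10 e0k e_gt0) _.
  have -> : 2 * k = s ^+ 2 by rewrite /k; field.
  by rewrite !lerD2l.
rewrite (RintD iq ik) (RintD _ iH); last exact: intg_cst.
rewrite Rint_cst; have : 3 * k <= 3 / 2 * s by rewrite /k; nra.
lra.
Qed.

End SparsePolynomials.

(** * Uniform polynomial approximation of the logarithm *)

Section LogApproximation.
Variable R : realType.

(** The function inside the absolute value vanishes at 0 and has derivative
    [- x ^ N / (1 - x)]; the mean value theorem gives the bound. *)
Lemma ln1B_taylor (rho : R) N (x : R) : 0 <= rho < 1 -> 0 <= x <= rho ->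
  `|ln (1 - x) + (\sum_(i < N) i.+1%:R^-1 *: 'X^(i.+1) : {poly R}).[x]| <=
  rho ^+ N / (1 - rho).
Proof.
move=> /andP[r0 r1] /andP[x0 xr].
set p := (\sum_(i < N) _ : {poly R}).
have dp y : p^`().[y] = \sum_(i < N) y ^+ i.
  rewrite /p raddf_sum horner_sum; apply: eq_bigr => i _ /=.
  rewrite derivZ derivXn hornerZ hornerMn hornerXn -(mulr_natl (y ^+ i)) mulrA.
  by rewrite mulVf ?mul1r// pnatr_eq0.
have p0 : p.[0] = 0.
  rewrite /p horner_sum big1// => i _.
  by rewrite hornerZ hornerXn expr0n mulr0.
pose f : R -> R := (@ln R \o (fun y => 1 - y)) + horner p.
pose df (y : R) := - (1 - y)^-1 + \sum_(i < N) y ^+ i.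
have fd (y : R) : y < 1 -> is_derive y 1 f (df y).
  move=> y1; rewrite /df -dp; apply: is_deriveD.
  rewrite -mulrN1; apply: is_derive1_comp.
    by apply: is_derive1_ln; rewrite subr_gt0.
  rewrite -[X in is_derive _ _ _ X]sub0r.
  exact: (is_deriveB (is_derive_cst _ _ _) (is_derive_id _ _)).
have [||c cx] := @MVT_segment R f df 0 x x0.
- by move=> y; rewrite in_itv/= => /andP[_ yx]; apply: fd; lra.
- apply: derivable_within_continuous => y; rewrite in_itv/= => /andP[_ yx].
  by have [] : is_derive y 1 f (df y) by apply: fd; lra.
have fE y : f y = ln (1 - y) + p.[y] by [].
rewrite !fE p0 subr0 ln1 addr0 subr0 => ->; rewrite subr0.
move: cx; rewrite in_itv/= => /andP[c0 cx].
have c1 : 0 < 1 - c by lra.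
have -> : df c = - (c ^+ N / (1 - c)).
  have := subrX1 c N; rewrite /df.
  set S := \sum_(_ < _) _ => h.
  by apply: (mulIf (lt0r_neq0 c1)); rewrite mulrDl !mulNr mulVf ?divfK ?lt0r_neq0//; lra.
have q0 : 0 <= c ^+ N / (1 - c) by rewrite divr_ge0 ?exprn_ge0// ltW.
rewrite mulNr normrN ger0_norm ?(mulr_ge0 q0 x0)// -[leRHS]mulr1; apply: ler_pM => //.
  apply: ler_pM; rewrite ?exprn_ge0 ?invr_ge0 ?(ltW c1)//.
    by rewrite lerXn2r ?nnegrE// (le_trans cx).
  by rewrite lef_pV2 ?posrE; lra.
lra.
Qed.

(** Write [u + e = (L + e) (1 - x)]; then [x] stays in an interval [[0, rho]] with
    [rho < 1], on which the Taylor series of [ln (1 - x)] converges uniformly. *)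
Lemma ln_poly_approx (L e eta : R) : 0 < e -> 0 < eta -> 0 <= L ->
  exists Q : {poly R}, forall u, 0 <= u <= L -> `|ln (u + e) - Q.[u]| <= eta.
Proof.
move=> e0 eta0 L0; pose c := L + e; pose rho := L / c.
have c0 : 0 < c by rewrite ltr_wpDl.
have rho01 : 0 <= rho < 1.
  by rewrite divr_ge0 ?(ltW c0)//= ltr_pdivrMr// mul1r ltrDl.
have [N HN] : exists N, rho ^+ N / (1 - rho) <= eta.
  have rho1 : 0 < 1 - rho by case/andP: rho01; lra.
  have nr : `|rho| < 1 by case/andP: rho01 => ? ?; rewrite ger0_norm.
  have d0 : 0 < eta * (1 - rho) by rewrite mulr_gt0.
  have /cvgrPdist_lt/(_ _ d0)[N _ /(_ N (leqnn N))] := cvg_expr nr.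
  rewrite sub0r normrN => h; exists N; rewrite ler_pdivrMr//.
  by rewrite (le_trans (ler_norm _))// ltW.
pose p : {poly R} := \sum_(i < N) i.+1%:R^-1 *: 'X^(i.+1).
exists ((ln c)%:P - (p \Po ((1 - e / c)%:P - c^-1 *: 'X))) => u /andP[u0 uL].
pose x := 1 - (u + e) / c.
have -> : ((ln c)%:P - (p \Po ((1 - e / c)%:P - c^-1 *: 'X))).[u] = ln c - p.[x].
  rewrite hornerD hornerN hornerC horner_comp hornerD hornerC hornerN hornerZ hornerX.
  by congr (_ - p.[_]); rewrite /x; field; rewrite gt_eqF.
have x01 : 0 <= x <= rho.
  have -> : rho = 1 - e / c by rewrite /rho /c; field; rewrite gt_eqF.
  rewrite subr_ge0 ler_pdivrMr// mul1r lerD2r uL lerD2l lerN2.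
  by rewrite ler_pM2r ?invr_gt0// lerDr.
have -> : ln (u + e) - (ln c - p.[x]) = ln (1 - x) + p.[x].
  rewrite /x subKr lnM ?posrE ?invr_gt0 ?ltr_wpDl// lnV ?posrE//; ring.
exact: le_trans (ln1B_taylor _ rho01 x01) HN.
Qed.

End LogApproximation.

(** * The Boyd height *)

Section BoydHeight.

Lemma boyd_height_le n m (A : 'M[int]_(n, m)) (M : nat) :
  (M%:Z%:E <= boyd_height A)%E ->
  forall v : 'rV[int]_n, v *m A = 0 -> (supnorm v < M)%N -> v = 0.
Proof.
rewrite /boyd_height; case: pselect => [ex|nex] Mh v vA vM; last first.
  apply/eqP/negP => /negP v0; apply: nex; exists (supnorm v).
  by apply/asboolP; exists v.
apply/eqP/negP => /negP v0.
have Hv : height_of_relation A (supnorm v) by apply/asboolP; exists v.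
move: Mh; case: ex_minnP => k _ /(_ _ Hv) kv.
rewrite lee_fin lez_nat leqNgt => /negP; apply; exact: leq_ltn_trans vM.
Qed.

Lemma boyd_height_ge n m (A : 'M[int]_(n, m)) (M : nat) :
  (forall v : 'rV[int]_n, v *m A = 0 -> (supnorm v < M)%N -> v = 0) ->
  (M%:Z%:E <= boyd_height A)%E.
Proof.
move=> H; rewrite /boyd_height; case: pselect => [ex|nex]; last by rewrite leey.
case: ex_minnP => k /asboolP[v [v0 vA <-]] _; rewrite lee_fin lez_nat leqNgt.
by apply/negP => /(H v vA)/eqP; apply/negP.
Qed.

Lemma supnorm_ge n (v : 'rV[int]_n) i : (`|v ord0 i| <= supnorm v)%N.
Proof. exact: (leq_bigmax (F := fun i => `|v ord0 i|%N)). Qed.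

(** Uniqueness of expansions in base [B] with digits of absolute value less than
    [B], when the value is 0: the lowest digit is a multiple of [B]. *)
Lemma digits_eq0 (B : nat) n (v : 'I_n -> int) :
  (forall i, (`|v i| < B)%N) -> \sum_(i < n) v i * (B%:Z ^+ i) = 0 ->
  forall i, v i = 0.
Proof.
elim: n v => [v _ _ []//|n IH v vB].
rewrite big_ord_recl expr0 mulr1.
under eq_bigr => i _ do rewrite lift0 exprS mulrCA.
rewrite -mulr_sumr; set S := \sum_(i < n) _ => h.
have B0 : (0 < B)%N by rewrite (leq_ltn_trans _ (vB ord0)).
have v0 : v ord0 = 0.
  have /dvdnP[q] : (B %| `|v ord0|)%N.
    have -> : v ord0 = - (B%:Z * S) by apply/eqP; rewrite -addr_eq0 h.
    by rewrite abszN abszM dvdn_mulr.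
  case: q => [|q] /eqP; first by rewrite mul0n absz_eq0 => /eqP.
  have := vB ord0; rewrite ltnNge => /negP/[swap] /eqP ->.
  by rewrite mulSn leq_addr => /(_ isT).
have S0 : S = 0.
  by move/eqP: h; rewrite v0 add0r mulf_eq0 eqz_nat gtn_eqF//= => /eqP.
move=> i; have [j ->|->//] := unliftP ord0 i.
exact: (IH (fun i => v (lift ord0 i))).
Qed.

(** The exponents [1, M, M ^ 2, ...] admit no short linear relation. *)
Lemma exists_large_height n (M : nat) :
  exists r : 'cV[int]_n, (M%:Z%:E <= boyd_height r)%E.
Proof.
exists (\col_i (M%:Z ^+ i)); apply: boyd_height_ge => v vr vM.
have H : \sum_(i < n) v ord0 i * (M%:Z ^+ i) = 0.
  transitivity ((v *m \col_i (M%:Z ^+ i)) ord0 ord0); last by rewrite vr mxE.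
  by rewrite mxE; apply: eq_bigr => i _; rewrite mxE.
apply/rowP => i; rewrite mxE.
apply: (digits_eq0 _ H) => j; exact: leq_ltn_trans (supnorm_ge v j) vM.
Qed.

Lemma seq_supnorm_bound n (s : seq 'rV[int]_n) :
  exists M, forall k, k \in s -> (supnorm k < M)%N.
Proof.
elim: s => [|k s [M HM]]; first by exists 0%N.
exists (maxn (supnorm k).+1 M) => l; rewrite in_cons leq_max => /orP[/eqP ->|/HM ->].
  by rewrite ltnSn.
by rewrite orbT.
Qed.

Lemma injective_large_height n (s : seq 'rV[int]_n) :
  exists M : nat, forall m (A : 'M[int]_(n, m)), (M%:Z%:E <= boyd_height A)%E ->
    {in s &, injective (fun k => k *m A)}.
Proof.
have [M HM] := seq_supnorm_bound [seq k - l | k <- s, l <- s].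
exists M => m A Ah k l ks ls kl; apply/eqP; rewrite -subr_eq0; apply/eqP.
apply: (boyd_height_le Ah); first by rewrite mulmxBl kl subrr.
by apply: HM; apply: allpairs_f.
Qed.

End BoydHeight.

(** * Trigonometric polynomials and equidistribution *)

Section TrigonometricPolynomials.
Variable R : realType.
Implicit Types n m : nat.

Definition mono n (k : 'rV[int]_n) (z : n.-tuple (circle R)) : R[i] :=
  monomial (k ord0) z.

Lemma monoE n (k : 'rV[int]_n) z :
  mono k z = \prod_j (tnth z j : R[i]) ^ k ord0 j.
Proof. by []. Qed.

Lemma mono0 n (z : n.-tuple (circle R)) : mono 0 z = 1.
Proof. by rewrite monoE big1// => j _; rewrite mxE expr0z. Qed.

Lemma monoD n (k l : 'rV[int]_n) z : mono (k + l) z = mono k z * mono l z.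
Proof.
rewrite !monoE -big_split/=; apply: eq_bigr => j _.
by rewrite mxE expfzDr// circle_neq0.
Qed.

Lemma nsq_mono n (k : 'rV[int]_n) z : nsq (mono k z) = 1.
Proof. exact: nsq_circle. Qed.

Lemma monoN n (k : 'rV[int]_n) z : mono (- k) z = ((mono k z)^*)%C.
Proof.
rewrite -nsq_conjV ?nsq_mono//.
have k0 : mono k z != 0 by exact: circle_neq0.
by apply: (mulfI k0); rewrite -monoD subrr mono0 mulfV.
Qed.

Lemma mono_torus_mul n (k : 'rV[int]_n) a z :
  mono k (torus_mul a z) = mono k a * mono k z.
Proof.
rewrite !monoE -big_split/=; apply: eq_bigr => j _.
by rewrite tnth_mktuple -expfzMl.
Qed.

Lemma mono_qmap n m (A : 'M[int]_(n, m)) (k : 'rV[int]_n) z :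
  mono k (qmap A z) = mono (k *m A) z.
Proof.
rewrite !monoE.
transitivity (\prod_(i < n) \prod_(j < m) (tnth z j : R[i]) ^ (k ord0 i * A i j)).
  apply: eq_bigr => i _; rewrite tnth_mktuple /=.
  rewrite (big_morph (fun x : R[i] => x ^ k ord0 i)
    (fun x y => expfzMl x y _) (exp1rz _ _)).
  by apply: eq_bigr => j _; rewrite exprz_exp mulrC.
rewrite exchange_big; apply: eq_bigr => j _ /=.
rewrite mxE; elim/big_rec2: _ => [|i x y _ ->]; first by rewrite expr0z.
by rewrite expfzDr// circle_neq0.
Qed.

Lemma expiXz (t : R) (k : int) : (expi t : R[i]) ^ k = expi (k%:~R * t).
Proof.
case: k => p; first by rewrite -exprnP expiX.
rewrite NegzE -exprnN expiX; apply: (mulfI (circle_neq0 (expi (p.+1%:R * t)))).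
rewrite mulfV ?circle_neq0// mulrNz mulNr.
have := expiD (p.+1%:R * t) (- (p.+1%:R * t)) => /(congr1 (@circle_val R)) /= <-.
by rewrite subrr cos0 sin0.
Qed.

(** A nontrivial character takes the value [-1]: this makes the vanishing of its
    integral an immediate consequence of the invariance of the measure. *)
Lemma mono_eqN1 n (k : 'rV[int]_n) : k != 0 ->
  exists a : n.-tuple (circle R), mono k a = -1.
Proof.
move=> k0; have [i ki] : exists i, k ord0 i != 0.
  apply/existsP; apply: contraNT k0; rewrite negb_exists => /forallP h.
  by apply/eqP/rowP => i; rewrite mxE; apply/eqP; have := h i; rewrite negbK.
exists [tuple expi (if j == i then pi / (k ord0 i)%:~R else 0) | j < n].
rewrite monoE (bigD1 i)//= tnth_mktuple eqxx expiXz big1 ?mulr1.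
  by rewrite mulrCA mulfV ?mulr1 ?expi_pi// intr_eq0.
by move=> j /negPf ji; rewrite tnth_mktuple ji expiXz mulr0 /= cos0 sin0.
Qed.

Lemma cbmeas_mono n (k : 'rV[int]_n) : cbmeas (mono k).
Proof.
have -> : mono k = fun z => \prod_j (tnth z j : R[i]) ^ k ord0 j by [].
apply: cbmeas_prod => j; case: (k ord0 j) => p.
  by under eq_fun do rewrite -exprnP; apply: cbmeasX; exact: cbmeas_tnth.
have -> : (fun z : n.-tuple (circle R) => (tnth z j : R[i]) ^ Negz p) =
    fun z => (((tnth z j : R[i]) ^+ p.+1)^*)%C.
  apply/funext => z; rewrite NegzE -exprnN nsq_conjV//.
  by rewrite nsqX nsq_circle expr1n.
by apply: cbmeas_conj; apply: cbmeasX; exact: cbmeas_tnth.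
Qed.

Lemma Rint_mono_eq0 n (k : 'rV[int]_n) : k != 0 ->
  \int[haar R n]_z complex.Re (mono k z) = 0 /\
  \int[haar R n]_z complex.Im (mono k z) = 0.
Proof.
move=> /mono_eqN1[a ka]; have [bR bI] := cbmeas_mono k.
have RintN (f : n.-tuple (circle R) -> R) : bmeas f ->
    (forall z, f (torus_mul a z) = - f z) -> \int[haar R n]_z f z = 0.
  move=> bf fN; have : \int[haar R n]_z f z = \int[haar R n]_z (-1 * f z).
    rewrite -(Rint_rotation a bf); apply: eq_Rintegral => z _.
    by rewrite fN mulN1r.
  by rewrite RintZ; [lra|exact: bmeas_intg].
by split; apply: RintN => // z; rewrite mono_torus_mul ka mulN1r ?complex_ReN ?complex_ImN.
Qed.

Definition trig n (s : seq (R[i] * 'rV[int]_n)) (z : n.-tuple (circle R)) : R[i] :=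
  \sum_(x <- s) x.1 * mono x.2 z.

Lemma cbmeas_trig n (s : seq (R[i] * 'rV[int]_n)) : cbmeas (trig s).
Proof.
rewrite /trig; apply: cbmeas_sum => x; apply: cbmeasM; first exact: cbmeas_cst.
exact: cbmeas_mono.
Qed.

Lemma trig_qmap n m (A : 'M[int]_(n, m)) (s : seq (R[i] * 'rV[int]_n)) z :
  trig s (qmap A z) = trig [seq (x.1, x.2 *m A) | x <- s] z.
Proof. by rewrite /trig big_map; apply: eq_bigr => x _; rewrite mono_qmap. Qed.

Lemma Rint_trig n (s : seq (R[i] * 'rV[int]_n)) :
  \int[haar R n]_z complex.Re (trig s z) =
  \sum_(x <- s | x.2 == 0) complex.Re x.1.
Proof.
elim: s => [|x s IH].
  rewrite big_nil /trig.
  by under eq_Rintegral do rewrite big_nil /=; rewrite Rint_cst.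
rewrite big_cons /trig.
under eq_Rintegral do rewrite big_cons complex_ReD complex_ReM.
have [bR bI] := cbmeas_mono x.2.
have bR' : intg (haar R n) (fun z => complex.Re x.1 * complex.Re (mono x.2 z)).
  by apply: intgZ; exact: bmeas_intg.
have bI' : intg (haar R n) (fun z => complex.Im x.1 * complex.Im (mono x.2 z)).
  by apply: intgZ; exact: bmeas_intg.
rewrite RintD; [|exact: intgB|by apply: bmeas_intg; have [] := cbmeas_trig s].
rewrite -/(trig s) IH RintB// !RintZ; [|exact: bmeas_intg..].
case: eqP => [->|/eqP /Rint_mono_eq0[-> ->]]; last by rewrite !mulr0 subrr add0r.
under eq_Rintegral do rewrite mono0 /=.
under [X in _ - _ * X]eq_Rintegral do rewrite mono0 /=.
by rewrite !Rint_cst mulr1 mulr0 subr0.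
Qed.

Definition is_trig n (f : n.-tuple (circle R) -> R) :=
  exists s : seq (R[i] * 'rV[int]_n), forall z, ((f z)%:C)%C = trig s z.

Lemma is_trig_cst n (c : R) : is_trig (fun _ : n.-tuple (circle R) => c).
Proof.
by exists [:: ((c%:C)%C, 0)] => z; rewrite /trig big_seq1 mono0 mulr1.
Qed.

Lemma is_trigD n (f g : n.-tuple (circle R) -> R) :
  is_trig f -> is_trig g -> is_trig (fun z => f z + g z).
Proof.
move=> [s fs] [t gt]; exists (s ++ t) => z.
by rewrite rmorphD /= fs gt /trig big_cat.
Qed.

Lemma trigM n (s t : seq (R[i] * 'rV[int]_n)) z :
  trig s z * trig t z = trig [seq (x.1 * y.1, x.2 + y.2) | x <- s, y <- t] z.
Proof.
rewrite /trig big_allpairs_dep big_distrlr; apply: eq_bigr => x _.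
by apply: eq_bigr => y _; rewrite /= monoD mulrACA.
Qed.

Lemma trig_conj n (s : seq (R[i] * 'rV[int]_n)) z :
  ((trig s z)^*)%C = trig [seq ((x.1^*)%C, - x.2) | x <- s] z.
Proof.
rewrite /trig big_map rmorph_sum; apply: eq_bigr => x _.
by rewrite rmorphM /= monoN.
Qed.

Lemma is_trigM n (f g : n.-tuple (circle R) -> R) :
  is_trig f -> is_trig g -> is_trig (fun z => f z * g z).
Proof.
by move=> [s fs] [t gt]; eexists => z; rewrite rmorphM /= fs gt trigM.
Qed.

Lemma is_trig_horner n (Q : {poly R}) (f : n.-tuple (circle R) -> R) :
  is_trig f -> is_trig (fun z => Q.[f z]).
Proof.
move=> tf; elim/poly_ind: Q => [|Q c IH].
  by under eq_fun do rewrite horner0; exact: is_trig_cst.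
under eq_fun do rewrite hornerMXaddC.
by apply: is_trigD; [exact: is_trigM|exact: is_trig_cst].
Qed.

Lemma is_trig_nsq n (s : seq (R[i] * 'rV[int]_n)) :
  is_trig (fun z => nsq (trig s z)).
Proof. by eexists => z; rewrite nsqE trig_conj trigM. Qed.

Lemma is_trig_qmap n m (A : 'M[int]_(n, m)) f :
  is_trig f -> is_trig (fun z => f (qmap A z)).
Proof. by move=> [s fs]; eexists => z; rewrite fs trig_qmap. Qed.

Lemma is_trig_bmeas n (f : n.-tuple (circle R) -> R) : is_trig f -> bmeas f.
Proof.
move=> [s fs]; have [bR _] := cbmeas_trig s.
have -> // : f = fun z => complex.Re (trig s z).
by apply/funext => z; rewrite -fs.
Qed.

(** The integral is the constant coefficient, and at large height no other
    monomial of [f] becomes constant after composition with [qmap A]: the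
    convergence is in fact an eventual equality. *)
Lemma Rint_is_trig n (f : n.-tuple (circle R) -> R) : is_trig f ->
  exists M : nat, forall m (A : 'M[int]_(n, m)), (M%:Z%:E <= boyd_height A)%E ->
    \int[haar R m]_z f (qmap A z) = \int[haar R n]_z f z.
Proof.
move=> [s fs]; have [M HM] := seq_supnorm_bound (map snd s).
exists M => m A Ah.
transitivity (\int[haar R m]_z complex.Re (trig [seq (x.1, x.2 *m A) | x <- s] z)).
  by apply: eq_Rintegral => z _; rewrite -trig_qmap -fs.
transitivity (\int[haar R n]_z complex.Re (trig s z)); last first.
  by apply: eq_Rintegral => z _; rewrite -fs.
rewrite !Rint_trig big_map/= big_seq_cond [RHS]big_seq_cond; apply: eq_bigl => x.
have [xs|//] := boolP (x \in s); rewrite /=.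
apply/eqP/eqP => [xA|->]; last by rewrite mul0mx.
by apply: (boyd_height_le Ah) => //; apply: HM; exact: map_f.
Qed.

(** The regularized logarithm is bounded, so that [ln_poly_approx] approximates
    [ln (u + e)] uniformly by polynomials in [u], to which [Rint_is_trig]
    applies. *)
Lemma Rint_ln_equidistribution n (u : n.-tuple (circle R) -> R) (e eta : R) :
  is_trig u -> (forall z, 0 <= u z) -> 0 < e -> 0 < eta ->
  exists M : nat, forall m (A : 'M[int]_(n, m)), (M%:Z%:E <= boyd_height A)%E ->
    `|\int[haar R n]_z ln (u z + e) - \int[haar R m]_z ln (u (qmap A z) + e)|
      <= eta.
Proof.
move=> tu u0 e0 eta0.
have [mu [L uL]] := is_trig_bmeas tu.
have L0 : 0 <= L by rewrite (le_trans _ (uL [tuple expi 0 | _ < n])).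
have [Q HQ] := ln_poly_approx e0 (divr_gt0 eta0 (ltr0Sn R 1)) L0.
have [M HM] := Rint_is_trig (is_trig_horner Q tu).
have HQu z : `|ln (u z + e) - Q.[u z]| <= eta / 2.
  by apply: HQ; rewrite u0 (le_trans (ler_norm _)).
exists M => m A Ah.
have iln k (v : k.-tuple (circle R) -> R) : is_trig v -> (forall z, 0 <= v z) ->
    intg (haar R k) (fun z => ln (v z + e)).
  by move=> tv v0; apply: bmeas_intg; apply: bmeas_lnD => //; exact: is_trig_bmeas.
have iQ k (v : k.-tuple (circle R) -> R) : is_trig v ->
    intg (haar R k) (fun z => Q.[v z]).
  by move=> tv; apply/bmeas_intg/is_trig_bmeas/is_trig_horner.
have tuA := is_trig_qmap A tu.
have h1 := Rint_dist (iln _ _ tu u0) (iQ _ _ tu) HQu.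
have h2 := Rint_dist (iln _ _ tuA (fun z => u0 _)) (iQ _ _ tuA) (fun z => HQu _).
rewrite HM// in h2; move: h1 h2; rewrite !ler_norml => /andP[h1 h2] /andP[h3 h4].
by apply/andP; split; lra.
Qed.

End TrigonometricPolynomials.

(** * Laurent polynomials *)

Section LaurentPolynomials.
Variable R : realType.

Lemma laurent_evalE n (P : laurent R n) z :
  laurent_eval P z = trig [seq (P k, k) | k <- finsupp P] z.
Proof. by rewrite /trig big_map. Qed.

Lemma laurent_neq0 n (P : laurent R n) :
  P != [fsfun] -> exists2 k, k \in finsupp P & P k != 0.
Proof.
move=> P0; have [k kP] : exists k, k \in finsupp P.
  apply: contrapT => h; move/eqP: P0; apply; apply/fsfunP => k.
  rewrite fsfunE; apply/eqP; rewrite -memNfinsupp; apply/negP => kP.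
  by apply: h; exists k.
by exists k; rewrite // -mem_finsupp.
Qed.

Lemma nsq_coef_lower_bound n (P : laurent R n) :
  exists2 c : R, 0 < c & forall k, k \in finsupp P -> c <= nsq (P k).
Proof.
suff H (s : seq 'rV[int]_n) : (forall k, k \in s -> 0 < nsq (P k)) ->
    exists2 c : R, 0 < c & forall k, k \in s -> c <= nsq (P k).
  by apply: (H (enum_fset (finsupp P))) => k; rewrite nsq_gt0 -mem_finsupp.
elim: s => [_|k s IH H]; first by exists 1.
have [|c c0 cs] := IH; first by move=> l ls; rewrite H ?in_cons ?ls ?orbT.
exists (Num.min (nsq (P k)) c); first by rewrite lt_min c0 andbT H ?mem_head.
move=> l; rewrite in_cons ge_min => /orP[/eqP ->|/cs ->]; first by rewrite lexx.
by rewrite orbT.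
Qed.

(** At large height the exponents [k r] are pairwise distinct, so that the
    restriction has the same coefficients as [P].  Multiplying by a power of [z]
    makes it a polynomial without changing its modulus on the circle. *)
Lemma sparse_restriction n (P : laurent R n) : P != [fsfun] ->
  exists M K, exists2 c : R, 0 < c &
  forall r : 'cV[int]_n, (M%:Z%:E <= boyd_height r)%E ->
  exists p : {poly R[i]}, [/\ (nterms p <= K)%N, c <= nsq (lead_coef p) &
    forall z, nsq (laurent_eval P (qmap r z)) = nsq p.[coord1 z]].
Proof.
move=> /laurent_neq0[k0 k0P Pk0].
have [M HM] := injective_large_height (enum_fset (finsupp P)).
have [c c_gt0 Hc] := nsq_coef_lower_bound P.
set S := enum_fset (finsupp P) in HM *.
exists M, (size S), c => // r rh; have inj := HM _ r rh.
pose e (k : 'rV[int]_n) : int := (k *m r) ord0 ord0.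
(* A shift that makes all exponents nonnegative. *)
pose m : nat := \sum_(k <- S) `|e k|%N.
pose f (k : 'rV[int]_n) : nat := absz (e k + m%:Z).
have fE k : k \in S -> (f k)%:Z = e k + m%:Z.
  move=> kS; rewrite /f gez0_abs//.
  have : `|e k| <= m%:Z.
    by rewrite -abszE lez_nat /m (big_rem k)//= leq_addr.
  by rewrite ler_norml => /andP[h _]; rewrite -lerBlDr sub0r.
have f_inj : {in S &, injective f}.
  move=> k l kS lS /(congr1 Posz); rewrite !fE// => /addIr kl.
  by apply: inj => //; apply/matrixP => i j; rewrite !ord1; exact: kl.
pose p : {poly R[i]} := \sum_(k <- S) P k *: 'X^(f k).
have pf k : k \in S -> p`_(f k) = P k.
  move=> kS; rewrite /p coef_sumMXn -big_filter.
  rewrite (_ : [seq l <- S | f l == f k] = [:: k]) ?big_seq1//.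
  rewrite (@eq_in_filter _ _ (pred1 k)); last first.
    by move=> l lS /=; apply/eqP/eqP => [/f_inj->|->].
  by rewrite filter_pred1_uniq// fset_uniq.
have p_out i : i \notin map f S -> p`_i = 0.
  move=> iS; rewrite /p coef_sumMXn big_seq_cond big1// => k /andP[kS /eqP fk].
  by move: iS; rewrite -fk map_f.
exists p; split.
- apply: (@leq_trans (\sum_(i < size p) \sum_(k <- S) (f k == i))).
    rewrite /nterms; apply: leq_sum => i _.
    case: eqP => //= /eqP pi0.
    have /mapP[k kS ->] : (i : nat) \in map f S.
      by apply: contraNT pi0 => /p_out ->.
    by rewrite (big_rem k)//= eqxx.
  rewrite exchange_big /= -[size S]sum1_size leq_sum// => k _.
  have [fk|fk] := ltnP (f k) (size p); last first.
    rewrite big1// => i _; apply/eqP; rewrite eqb0; apply/eqP => fki.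
    by move: fk; rewrite fki leqNgt ltn_ord.
  rewrite (bigD1 (Ordinal fk))//= eqxx big1// => i /eqP ik.
  by apply/eqP; rewrite eqb0; apply/eqP => fki; apply: ik; exact: val_inj.
- have p0 : p != 0.
    apply: contraNneq Pk0 => p0; rewrite -pf//.
    by rewrite p0 coef0.
  have : lead_coef p != 0 by rewrite lead_coef_eq0.
  rewrite lead_coefE => pn; have /mapP[k kS ->] : (size p).-1 \in map f S.
    by apply: contraNT pn => /p_out ->.
  by rewrite pf// Hc.
- move=> z; rewrite laurent_evalE trig_qmap.
  set w := coord1 z; have w0 : w != 0 by rewrite -nsq_gt0 nsq_coord1.
  have -> : p.[w] = w ^+ m *
      trig [seq (x.1, x.2 *m r) | x <- [seq (P k, k) | k <- S]] z.
    rewrite /trig !big_map /p horner_sum mulr_sumr !big_seq; apply: eq_bigr => k kS /=.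
    rewrite hornerZ hornerXn mulrCA; congr (_ * _).
    rewrite monoE big_ord1 -/(coord1 z) -/w -/(e k).
    by rewrite (exprnP w (f k)) (exprnP w m) -expfzDr// addrC -fE.
  by rewrite nsqM nsqX nsq_coord1 expr1n mul1r.
Qed.

Definition laurent_nsq n (P : laurent R n) z : R := nsq (laurent_eval P z).

Lemma laurent_nsq_ge0 n (P : laurent R n) z : 0 <= laurent_nsq P z.
Proof. exact: nsq_ge0. Qed.

Lemma is_trig_laurent_nsq n (P : laurent R n) : is_trig (laurent_nsq P).
Proof.
have -> : laurent_nsq P = fun z => nsq (trig [seq (P k, k) | k <- finsupp P] z).
  by apply/funext => z; rewrite /laurent_nsq laurent_evalE.
exact: is_trig_nsq.
Qed.

(** On the circle this is [sparse_log_control].  The estimate on the n-torus is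
    inherited from the circle: for fixed [e0] and [e] both sides of the inequality
    are limits of the corresponding integrals along [r] of growing height. *)
Lemma laurent_nsq_control n (P : laurent R n) (eta : R) : P != [fsfun] -> 0 < eta ->
  exists e0, exists M, 0 < e0 /\ forall e, 0 < e < e0 ->
    (forall r : 'cV[int]_n, (M%:Z%:E <= boyd_height r)%E ->
      \int[haar R 1]_z ln (laurent_nsq P (qmap r z) + e0) -
      \int[haar R 1]_z ln (laurent_nsq P (qmap r z) + e) <= eta) /\
    \int[haar R n]_z ln (laurent_nsq P z + e0) -
    \int[haar R n]_z ln (laurent_nsq P z + e) <= eta.
Proof.
move=> /sparse_restriction[M [K [c c0 H]]] eta0.
have [e0 e00 He] := sparse_log_control K c0 eta0.
exists e0, M; split=> // e ee0; have /andP[e_gt0 _] := ee0.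
have H1 (r : 'cV[int]_n) : (M%:Z%:E <= boyd_height r)%E ->
      \int[haar R 1]_z ln (laurent_nsq P (qmap r z) + e0) -
      \int[haar R 1]_z ln (laurent_nsq P (qmap r z) + e) <= eta.
  move=> /H[p [pK cp pE]]; have := He p pK cp e ee0.
  by congr (_ - _ <= _); apply: eq_Rintegral => z _; rewrite /laurent_nsq pE.
split=> //; apply/ler_addgt0Pr => d d0.
have d20 : 0 < d / 2 by rewrite divr_gt0.
have [M1 HM1] := Rint_ln_equidistribution (is_trig_laurent_nsq P) (laurent_nsq_ge0 P) e00 d20.
have [M2 HM2] := Rint_ln_equidistribution (is_trig_laurent_nsq P) (laurent_nsq_ge0 P) e_gt0 d20.
have [r rh] := exists_large_height n (maxn M (maxn M1 M2)).
have le M' : (M' <= maxn M (maxn M1 M2))%N -> (M'%:Z%:E <= boyd_height r)%E.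
  by move=> h; apply: le_trans rh; rewrite lee_fin lez_nat.
have h := H1 r (le _ (leq_maxl _ _)).
have := HM1 _ r (le _ (leq_trans (leq_maxl _ _) (leq_maxr _ _))).
have := HM2 _ r (le _ (leq_trans (leq_maxr _ _) (leq_maxr _ _))).
rewrite !ler_norml => /andP[h1 h2] /andP[h3 h4].
lra.
Qed.

Lemma log_absE n (P : laurent R n) z : 0 < laurent_nsq P z ->
  log_abs P z = Some (((1 / 2 * ln (laurent_nsq P z))%:C)%C).
Proof.
move=> u0; rewrite /log_abs; case: ifPn => [/eqP P0|_].
  by move: u0; rewrite /laurent_nsq P0 nsq0 ltxx.
congr (Some _%:C%C); rewrite Re_normc -/(laurent_nsq P z).
rewrite -[in RHS](sqr_sqrtr (laurent_nsq_ge0 P z)) lnXn ?sqrtr_gt0//.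
by rewrite mulr2n; field.
Qed.

Lemma represents_log n (g : pfun R n) (u : n.-tuple (circle R) -> R) :
  {ae haar R n, forall z, 0 < u z} -> intg (haar R n) (fun z => ln (u z)) ->
  (forall z, 0 < u z -> g z = Some (((1 / 2 * ln (u z))%:C)%C)) ->
  represents (fun z => ((1 / 2 * ln (u z))%:C)%C) g.
Proof.
move=> u0 iu gE; split; last by apply: filterS u0 => z; exact: gE.
by split; [exact: intgZ|exact: intg_cst].
Qed.

Lemma cintegral_log n (u : n.-tuple (circle R) -> R) :
  intg (haar R n) (fun z => ln (u z)) ->
  cintegral (fun z => ((1 / 2 * ln (u z))%:C)%C) =
  ((1 / 2 * \int[haar R n]_z ln (u z))%:C)%C.
Proof. by move=> iu; rewrite /cintegral /= RintZ// Rint_cst. Qed.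

Lemma represents_log_abs n (P : laurent R n) : P != [fsfun] ->
  intg (haar R n) (fun z => ln (laurent_nsq P z)) /\
  represents (fun z => ((1 / 2 * ln (laurent_nsq P z))%:C)%C) (log_abs P).
Proof.
move=> P0; have [e0 [M [e00 H]]] := laurent_nsq_control P0 ltr01.
have [h1 h2 _ _] := ln_regularized_limit (laurent_nsq_ge0 P)
  (is_trig_bmeas (is_trig_laurent_nsq P)) e00 (fun e He => (H e He).2).
by split=> //; apply: represents_log => // z; exact: log_absE.
Qed.

(** The Laurent polynomial of [P] composed with [qmap A]: exponents [k] with the
    same image [k *m A] are merged. *)
Definition laurent_pullback n m (A : 'M[int]_(n, m)) (P : laurent R n) : laurent R m :=
  [fsfun l in [fset (k *m A)%R | k in finsupp P]%fset =>
     \sum_(k <- finsupp P | k *m A == l) P k].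

Lemma laurent_eval_pullback n m (A : 'M[int]_(n, m)) (P : laurent R n) z :
  laurent_eval (laurent_pullback A P) z = laurent_eval P (qmap A z).
Proof.
pose T := [fset (k *m A)%R | k in finsupp P]%fset.
have -> : laurent_eval (laurent_pullback A P) z = \sum_(l <- T) laurent_pullback A P l * mono l z.
  rewrite /laurent_eval; apply: big_fset_incl.
    by apply/fsubsetP => l; rewrite mem_finsupp fsfunE; case: ifP; rewrite ?eqxx.
  by move=> l _; rewrite memNfinsupp => /eqP ->; rewrite mul0r.
rewrite laurent_evalE trig_qmap /trig !big_map /=.
under eq_big_seq => l lT do rewrite /laurent_pullback fsfunE lT mulr_suml big_mkcond.
rewrite exchange_big /= big_seq [RHS]big_seq; apply: eq_bigr => k kP.
have kT : k *m A \in T by apply: in_imfset.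
rewrite (bigD1_seq (k *m A)) ?fset_uniq//= eqxx big1_seq ?addr0// => l /andP[/negPf lk _].
by rewrite eq_sym lk.
Qed.

End LaurentPolynomials.

Theorem proposition4p3 (R : realType) : Boyd_Lawton (@C2 R).
Proof.
split.
- move=> n _ _ [P P0 ->]; have [_ h] := represents_log_abs P0.
  by eexists; exact: h.
- move=> n _ _ [P P0 ->] eps eps0.
  have [e0 [M [e00 H]]] := laurent_nsq_control P0 eps0.
  have e3 : 0 < eps / 3 by rewrite divr_gt0.
  have [M1 HM1] := Rint_ln_equidistribution (is_trig_laurent_nsq P) (laurent_nsq_ge0 P) e00 e3.
  exists (maxn M M1) => r rh.
  have le M' : (M' <= maxn M M1)%N -> (M'%:Z%:E <= boyd_height r)%E.
    by move=> h; apply: le_trans rh; rewrite lee_fin lez_nat.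
  have rM := le _ (leq_maxl _ _); have := HM1 _ r (le _ (leq_maxr _ _)).
  have [iP rP] := represents_log_abs P0.
  have [_ _ a1 a2] := ln_regularized_limit (laurent_nsq_ge0 P)
    (is_trig_bmeas (is_trig_laurent_nsq P)) e00 (fun e He => (H e He).2).
  have [b1 b2 b3 b4] := ln_regularized_limit (fun z => laurent_nsq_ge0 P (qmap r z))
    (is_trig_bmeas (is_trig_qmap r (is_trig_laurent_nsq P))) e00
    (fun e He => (H e He).1 r rM).
  have rr : represents (fun z => ((1 / 2 * ln (laurent_nsq P (qmap r z)))%:C)%C)
      (Defs.pcomp (log_abs P) r).
    by apply: represents_log b1 b2 _ => z; exact: log_absE.
  move=> h; split; first by eexists; exact: rr.
  rewrite (pintegralE rP) (pintegralE rr) !cintegral_log//.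
  rewrite -rmorphB normc_def /= expr0n addr0 sqrtr_sqr ltcR -mulrBr.
  move: h; rewrite ler_norml => /andP[h1 h2].
  (* The factor 1/2 turns the error eps + eps/3 into less than eps. *)
  by rewrite ltr_norml; apply/andP; split; lra.
- move=> n _ _ [P P0 ->].
  have [k0 k0P Pk0] := laurent_neq0 P0.
  have [B HB] := injective_large_height (enum_fset (finsupp P)).
  exists B => m _ A /HB inj; exists (laurent_pullback A P).
    apply: contraNneq Pk0 => /(congr1 (fun Q : laurent R m => Q (k0 *m A))).
    have kT : k0 *m A \in [fset (k *m A)%R | k in finsupp P]%fset.
      by apply: in_imfset.
    rewrite /laurent_pullback !fsfunE kT.
    rewrite -big_filter (_ : [seq k <- _ | _] = [:: k0]) ?big_seq1 => [->//|].
    rewrite (@eq_in_filter _ _ (pred1 k0)); last first.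
      by move=> l lS /=; apply/eqP/eqP => [/inj->|->].
    by rewrite filter_pred1_uniq ?fset_uniq.
  apply/funext => z; rewrite /Defs.pcomp /log_abs laurent_eval_pullback.
  by [].
Qed.
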